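(* Let $f(z) = z + a_2 z^2 + a_3 z^3 + \cdots$ belong to $\mathcal{C}_e$, with $\gamma_1=\frac12 a_2$ real. Then $$-\frac{1}{144}\le T_{2,1}\!\left(F_f/\gamma\right)\le\frac{15}{256},$$ where $T_{2,1}(F_f/\gamma)=\gamma_1^2-|\gamma_2|^2$. Both inequalities are sharp, i.e. each is attained with equality by some such function $f$.
   Context: $\mathbb{D}=\{z\in\mathbb{C}:|z|<1\}$. $\mathcal{S}$ is the class of univalent analytic functions $f$ on $\mathbb{D}$ with $f(0)=0$, $f'(0)=1$, written $f(z)=z+\sum_{n\ge2}a_nz^n$. For analytic $g,h$ on $\mathbb{D}$, $g\prec h$ (subordination) means that there is an analytic $\omega:\mathbb{D}\to\mathbb{D}$ with $\omega(0)=0$ and $g(z)=h(\omega(z))$ for $z\in\mathbb{D}$. The class $\mathcal{C}_e$ is $$\mathcal{C}_e=\left\{f\in\mathcal{S}:\ 1+\frac{zf''(z)}{f'(z)}\prec e^z,\ z\in\mathbb{D}\right\}.$$ The logarithmic coefficients $\gamma_n$ of $f\in\mathcal{S}$ are defined by $F_f(z)=\log\frac{f(z)}{z}=2\sum_{n=1}^\infty\gamma_nz^n$, with $\log1=0$; thus $\gamma_1=\frac12a_2$ and $\gamma_2=\frac12\left(a_3-\frac12a_2^2\right)$. The second-order Hermitian-Toeplitz determinant of the logarithmic coefficients is $T_{2,1}(F_f/\gamma)=\gamma_1^2-|\gamma_2|^2=\frac1{16}\left(-a_2^4+4a_2^2+4a_2^2\operatorname{Re}(a_3)-4|a_3|^2\right)$,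 where the diagonal entry $\gamma_1$ of the Hermitian-Toeplitz matrix is real. *)

(* Defs.v *)
From Stdlib Require Import Reals.
From Coquelicot Require Import Coquelicot.

(* Functions on the unit disc are represented by total functions C -> C whose
   values outside the disc are irrelevant: the disc is open, so derivatives at
   its points only depend on the values inside it. *)
Definition unit_disc (z : C) : Prop := (Cmod z < 1)%R.

Definition analytic_on_disc (f : C -> C) : Prop :=
  forall z : C, unit_disc z ->
    @ex_derive C_AbsRing C_NormedModule f z.

Definition univalent_on_disc (f : C -> C) : Prop :=
  forall z w : C, unit_disc z -> unit_disc w -> f z = f w -> z = w.

Definition class_S (f : C -> C) : Prop :=
  analytic_on_disc f /\ univalent_on_disc f /\
  f (RtoC 0) = RtoC 0 /\ C_derive f (RtoC 0) = RtoC 1.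

Definition Cexp (z : C) : C :=
  Cmult (RtoC (exp (Re z))) (cos (Im z), sin (Im z)).

Definition subordinate (g h : C -> C) : Prop :=
  exists omega : C -> C,
    analytic_on_disc omega /\
    (forall z : C, unit_disc z -> unit_disc (omega z)) /\
    omega (RtoC 0) = RtoC 0 /\
    (forall z : C, unit_disc z -> g z = h (omega z)).

(* The convention 0^-1 = 0 plays no role in the quotient: the derivative of a
   univalent function has no zero. *)
Definition class_Ce (f : C -> C) : Prop :=
  class_S f /\
  subordinate
    (fun z : C => (1 + z * C_derive (C_derive f) z / C_derive f z)%C)
    Cexp.

(* F is the branch of log (f(z)/z) on the disc with log 1 = 0, where f(z)/z is
   given the value f'(0) = 1 at z = 0. *)
Definition is_log_quotient (f F : C -> C) : Prop :=
  analytic_on_disc F /\ F (RtoC 0) = RtoC 0 /\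
  (forall z : C, unit_disc z -> z <> RtoC 0 -> Cexp (F z) = (f z / z)%C).

(* F(z) = 2 (gamma_1 z + gamma_2 z^2 + ...) on the disc; the sequence starts at
   index 0, and F(0) = 0 forces gamma_0 = 0. *)
Definition log_coefficients (f : C -> C) (gamma : nat -> C) : Prop :=
  exists F : C -> C, is_log_quotient f F /\
    (forall z : C, unit_disc z ->
       @is_pseries C_AbsRing C_NormedModule
         (fun n : nat => (2 * gamma n)%C) z (F z)).

(* Determinant of the Hermitian-Toeplitz matrix with rows (gamma_1, gamma_2)
   and (conj gamma_2, gamma_1), whose diagonal entry gamma_1 is real. *)
Definition T21 (gamma : nat -> C) : R :=
  (Re (gamma 1%nat) ^ 2 - Cmod (gamma 2%nat) ^ 2)%R.

(* Main.v *)
Require Import Defs.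
From Stdlib Require Import Reals Lra Lia Classical ClassicalEpsilon List.
From Coquelicot Require Import Coquelicot.
Open Scope R_scope.

(** Write [1 + z f''/f' = e^w] with a Schwarz function [w = c1 z + c2 z^2 + ...], and
    [F = log (f(z)/z)].  Comparing coefficients gives [c1 = 4 gamma_1] and
    [c2 = 12 (gamma_2 - gamma_1^2)], so the Schwarz-Pick inequality [|c2| <= 1 - |c1|^2]
    becomes [|gamma_2 - gamma_1^2| <= (1 - 16 gamma_1^2) / 12]
    ([second_coefficient_bound]).  For real [gamma_1] this confines [|gamma_2|] to an
    interval depending on [X = gamma_1^2], [0 <= X <= 1/16]; the least value of
    [X - |gamma_2|^2] that this allows occurs at [X = 0] and the greatest at [X = 1/16]
    ([T21_bounds]).  They are attained for [w = z^2] and [w = z].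

    Schwarz-Pick is proved without Cauchy's integral theorem.  What replaces it is the
    remark that [|g|^2 + eps |z|^2] has a positive Laplacian when [g] is twice complex
    differentiable, hence no interior maximum; adding [eta ln |z|^2], which is harmonic and
    tends to -oo at 0, gives a maximum principle that ignores an isolated singularity of a
    bounded function ([punctured_maximum_principle]).  It is applied to [w(z)/z] and then
    to the first Schur transform of [w].  The regularity of [w] comes from the hypothesis
    that [F] is a power series: such sums are infinitely differentiable
    ([disc_series_derivative]), [f = z e^F], and [w' = P'/P] where
    [P = 1 + z f''/f'].  This needs [f'] to have no zero, which follows from the
    differential equation [z f'' = (e^w - 1) f'] by a Gronwall argument on rays
    ([ode_nonvanishing]).

    For the extremal functions, [f' = g] is built from the recursion for the coefficients of
    the solution of [g' = h g], with [h = (e^w - 1)/z].  Then [f' = e^E] where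
    [E(z) = h_0 z + h_1 z^2 / 2 + ...] satisfies [|E| <= 3/2 < pi/2], so [Re f' > 0] and
    [f] is univalent.  That [log (f(z)/z)] is a power series on the whole disc is seen on
    coefficients: [f(z)/z = 1 + b_1 z + b_2 z^2 + ...] has [b_n >= 0] with sum at most 1,
    and then the logarithm has bounded coefficients ([log_coefficients_exist]). *)

(** * Complex derivatives *)

Definition cder (f : C -> C) (z l : C) : Prop :=
  @is_derive C_AbsRing C_NormedModule f z l.

Lemma cder_eps (f : C -> C) (z l : C) :
  cder f z l <->
  (forall eps : R, 0 < eps -> exists delta : R, 0 < delta /\
     forall w : C, Cmod (w - z) < delta ->
       Cmod (f w - f z - l * (w - z)) <= eps * Cmod (w - z)).
Proof.
  split.
  - intros [_ H] eps He.
    specialize (H z (fun P HP => HP) (mkposreal eps He)).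
    destruct H as [d Hd]. exists d. split. apply cond_pos.
    intros w Hw. specialize (Hd w Hw). unfold norm in Hd; simpl in Hd.
    replace (l * (w - z))%C with ((w - z) * l)%C by ring.
    exact Hd.
  - intros H. split. apply is_linear_scal_l.
    intros y Hy.
    apply (@is_filter_lim_locally_unique C_AbsRing (AbsRing_NormedModule C_AbsRing)) in Hy.
    subst y.
    intros eps. destruct (H eps (cond_pos eps)) as [d [Hd Hw]].
    exists (mkposreal d Hd). intros w Hwd.
    specialize (Hw w Hwd).
    replace (l * (w - z))%C with ((w - z) * l)%C in Hw by ring.
    exact Hw.
Qed.

Lemma cder_ext_loc (f g : C -> C) (z l : C) (d : R) : 0 < d ->
  (forall w, Cmod (w - z) < d -> f w = g w) -> cder f z l -> cder g z l.
Proof.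
  intros Hd He Hf. apply (is_derive_ext_loc f); [|exact Hf].
  exists (mkposreal d Hd). intros w Hw. apply He. exact Hw.
Qed.

Lemma cder_cont (f : C -> C) (z l : C) : cder f z l ->
  forall eps, 0 < eps -> exists delta, 0 < delta /\
    forall w, Cmod (w - z) < delta -> Cmod (f w - f z) < eps.
Proof.
  intros H eps He. rewrite cder_eps in H.
  destruct (H 1 Rlt_0_1) as [d [Hd Hw]].
  pose proof (Cmod_ge_0 l).
  assert (Hp : 0 < eps / (Cmod l + 2)) by (apply Rdiv_lt_0_compat; lra).
  exists (Rmin d (eps / (Cmod l + 2))). split.
  apply Rmin_pos; lra.
  intros w Hwd.
  assert (H1 := Rlt_le_trans _ _ _ Hwd (Rmin_l _ _)).
  assert (H2 := Rlt_le_trans _ _ _ Hwd (Rmin_r _ _)).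
  specialize (Hw w H1).
  replace (f w - f z)%C with ((f w - f z - l * (w - z)) + l * (w - z))%C by ring.
  eapply Rle_lt_trans. apply Cmod_triangle. rewrite Cmod_mult.
  apply (Rmult_lt_compat_r (Cmod l + 2)) in H2; [|lra].
  unfold Rdiv in H2. rewrite Rmult_assoc, Rinv_l, Rmult_1_r in H2 by lra.
  pose proof (Cmod_ge_0 (w - z)). nra.
Qed.

Lemma cder_const (c z : C) : cder (fun _ => c) z 0.
Proof. exact (@is_derive_const C_AbsRing C_NormedModule c z). Qed.

Lemma cder_id (z : C) : cder (fun w => w) z 1.
Proof.
  apply cder_eps. intros eps He. exists 1. split; [lra|]. intros w _.
  replace (w - z - 1 * (w - z))%C with (RtoC 0) by ring.
  rewrite Cmod_0. pose proof (Cmod_ge_0 (w-z)). nra.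
Qed.

Lemma cder_plus (f g : C -> C) (z a b : C) :
  cder f z a -> cder g z b -> cder (fun w => f w + g w)%C z (a + b)%C.
Proof. intros. exact (is_derive_plus f g z a b H H0). Qed.

Lemma cder_opp (f : C -> C) (z a : C) :
  cder f z a -> cder (fun w => - f w)%C z (- a)%C.
Proof. intros. exact (is_derive_opp f z a H). Qed.

Lemma cder_minus (f g : C -> C) (z a b : C) :
  cder f z a -> cder g z b -> cder (fun w => f w - g w)%C z (a - b)%C.
Proof. intros. exact (is_derive_minus f g z a b H H0). Qed.

(** The generic product and chain rules need functions into the scalar ring seen as a module
    over itself.  Its norm is that of the normed space of complex numbers; only the uniform
    structures, balls against squares, are different terms. *)
Lemma cder_absring (f : C -> C) (z l : C) :
  cder f z l <-> @is_derive C_AbsRing (AbsRing_NormedModule C_AbsRing) f z l.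
Proof.
  split; intros [_ H]; (split; [apply is_linear_scal_l|exact H]).
Qed.

Lemma cder_mult (f g : C -> C) (z a b : C) :
  cder f z a -> cder g z b -> cder (fun w => f w * g w)%C z (a * g z + f z * b)%C.
Proof.
  rewrite !cder_absring. intros Hf Hg.
  exact (is_derive_mult f g z a b Hf Hg Cmult_comm).
Qed.

Lemma cder_comp (f g : C -> C) (z a b : C) :
  cder f (g z) a -> cder g z b -> cder (fun w => f (g w)) z (b * a)%C.
Proof.
  intros Hf Hg. rewrite cder_absring in Hg.
  exact (is_derive_comp f g z a b Hf Hg).
Qed.

Lemma cder_eq (f : C -> C) (z a b : C) : a = b -> cder f z a -> cder f z b.
Proof. intros ->. auto. Qed.

Lemma cder_unique (f : C -> C) (z a b : C) : cder f z a -> cder f z b -> a = b.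
Proof.
  intros Ha Hb. rewrite <- (is_C_derive_unique f z a Ha). 
  apply (is_C_derive_unique f z b Hb).
Qed.

Lemma cder_inv (z : C) : z <> 0 -> cder (fun w => / w)%C z (- / (z * z))%C.
Proof.
  intros Hz. apply cder_eps. intros eps He.
  assert (Hm : 0 < Cmod z) by (apply Cmod_gt_0; exact Hz).
  set (d := Rmin (Cmod z / 2) (eps * (Cmod z * Cmod z * Cmod z) / 2)).
  assert (Hc : 0 < Cmod z * Cmod z * Cmod z) by (repeat apply Rmult_lt_0_compat; lra).
  assert (Hd : 0 < d) by (apply Rmin_pos; [lra|]; nra).
  exists d. split; [exact Hd|]. intros w Hw.
  assert (H1 := Rlt_le_trans _ _ _ Hw (Rmin_l _ _)).
  assert (H2 := Rlt_le_trans _ _ _ Hw (Rmin_r _ _)).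
  assert (Hwz : Cmod z / 2 < Cmod w).
  { assert (Cmod z <= Cmod w + Cmod (w - z)).
    { replace z with (w + - (w - z))%C at 1 by ring.
      eapply Rle_trans. apply Cmod_triangle. rewrite Cmod_opp. lra. }
    lra. }
  assert (Hw0 : w <> 0). { intros E. rewrite E, Cmod_0 in Hwz. lra. }
  replace (/ w - / z - - / (z * z) * (w - z))%C
    with ((w - z) * ((w - z) / (w * (z * z))))%C by (field; auto).
  rewrite Cmod_mult, Cmod_div by (repeat apply Cmult_neq_0; auto).
  rewrite !Cmod_mult, Rmult_comm.
  apply Rmult_le_compat_r. apply Cmod_ge_0.
  apply Rle_div_l. apply Rmult_lt_0_compat; [lra|nra].
  apply Rle_trans with (eps * (Cmod z * Cmod z * Cmod z) / 2). lra.
  assert (0 < eps * (Cmod z * Cmod z)) by nra. nra.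
Qed.

Lemma cder_div (f g : C -> C) (z a b : C) : g z <> 0 ->
  cder f z a -> cder g z b ->
  cder (fun w => f w / g w)%C z ((a * g z - f z * b) / (g z * g z))%C.
Proof.
  intros Hz Hf Hg.
  eapply cder_eq; [|exact (cder_mult _ _ _ _ _ Hf (cder_comp _ _ _ _ _ (cder_inv _ Hz) Hg))].
  cbv beta. field. exact Hz.
Qed.

(** Real calculus enters through the functions [t |-> Re (c f(p + t d))]; the factor [c]
    makes real parts, imaginary parts and scalar products special cases. *)
Lemma rder_line (f : C -> C) (p d l c : C) (t0 : R) :
  cder f (p + t0 * d)%C l ->
  is_derive (fun t : R => Re (c * f (p + t * d)%C)) t0 (Re (c * (l * d))).
Proof.
  intros H. apply is_derive_Reals. intros eps He.
  rewrite cder_eps in H.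
  set (K := Cmod c * Cmod d + 1).
  assert (HK : 0 < K) by (unfold K; pose proof (Cmod_ge_0 c); pose proof (Cmod_ge_0 d); nra).
  destruct (H (eps / (2 * K))) as [dl [Hdl Hw]]. apply Rdiv_lt_0_compat; lra.
  assert (Hp : 0 < dl / (Cmod d + 1)) by (apply Rdiv_lt_0_compat; pose proof (Cmod_ge_0 d); lra).
  exists (mkposreal _ Hp). intros h Hh Hhd. simpl in Hhd.
  specialize (Hw (p + (t0 + h)%R * d)%C).
  replace (p + (t0 + h)%R * d - (p + t0 * d))%C with (h * d)%C in Hw
    by (rewrite RtoC_plus; ring).
  rewrite Cmod_mult, Cmod_R in Hw.
  assert (Hah : 0 < Rabs h) by (apply Rabs_pos_lt; exact Hh).
  pose proof (Cmod_ge_0 d) as Hd0. pose proof (Cmod_ge_0 c) as Hc0.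
  assert (Hlt : Rabs h * Cmod d < dl).
  { apply Rlt_div_r in Hhd; [|lra]. nra. }
  specialize (Hw Hlt).
  set (A := (f (p + (t0 + h)%R * d) - f (p + t0 * d) - l * (h * d))%C) in *.
  replace ((Re (c * f (p + (t0 + h)%R * d)%C) - Re (c * f (p + t0 * d)%C)) / h - Re (c * (l * d)))
    with (Re (c * A)%C / h).
  2:{ unfold A. generalize (f (p + (t0 + h)%R * d)%C) (f (p + t0 * d)%C). intros X Y.
      destruct c, l, d, X, Y. simpl. field. exact Hh. }
  unfold Rdiv. rewrite Rabs_mult, Rabs_inv.
  apply Rlt_div_l. exact Hah.
  eapply Rle_lt_trans. apply re_le_Cmod. rewrite Cmod_mult.
  assert (Cmod c * Cmod A <= Cmod c * (eps / (2 * K) * (Rabs h * Cmod d))).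
  { apply Rmult_le_compat_l; auto. }
  eapply Rle_lt_trans. exact H0.
  replace (Cmod c * (eps / (2 * K) * (Rabs h * Cmod d))) with
    ((Cmod c * Cmod d) / K * (eps / 2 * Rabs h)) by (field; lra).
  assert ((Cmod c * Cmod d) / K <= 1). { apply Rle_div_l. lra. unfold K. lra. }
  assert (0 < eps / 2 * Rabs h) by nra. nra.
Qed.

(** The mean value theorem fails for complex values, but holds after pairing with a fixed
    [c].  The choice of [c] gives the mean value inequality, and univalence when the
    derivative has positive real part. *)
Lemma complex_mvt (f f1 : C -> C) (a b c : C) :
  (forall t : R, 0 <= t <= 1 -> cder f (a + t * (b - a))%C (f1 (a + t * (b - a))%C)) ->
  exists t : R, 0 <= t <= 1 /\
    Re (c * (f b - f a))%C = Re (c * (f1 (a + t * (b - a))%C * (b - a)))%C.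
Proof.
  intros H.
  assert (Hd : forall t : R, 0 <= t <= 1 ->
    is_derive (fun t : R => Re (c * f (a + t * (b - a))%C)) t (Re (c * (f1 (a + t * (b - a))%C * (b - a))))).
  { intros t Ht. apply rder_line. apply H. exact Ht. }
  destruct (MVT_gen (fun t : R => Re (c * f (a + t * (b - a))%C)) 0 1
    (fun t : R => Re (c * (f1 (a + t * (b - a))%C * (b - a))))) as [t [Ht E]].
  - intros x Hx. rewrite Rmin_left, Rmax_right in Hx by lra. apply Hd. lra.
  - intros x Hx. rewrite Rmin_left, Rmax_right in Hx by lra.
    apply derivable_continuous_pt. exists (Re (c * (f1 (a + x * (b - a))%C * (b - a)))).
    apply is_derive_Reals. apply Hd. lra.
  - rewrite Rmin_left, Rmax_right in Ht by lra. exists t. split. exact Ht.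
    replace (a + 1 * (b - a))%C with b in E by ring.
    replace (a + 0 * (b - a))%C with a in E by ring.
    replace (Re (c * (f b - f a))%C) with (Re (c * f b)%C - Re (c * f a)%C).
    rewrite E. ring. destruct c, (f a), (f b); simpl; ring.
Qed.

(** Duality for the modulus: the witness is [c = conj x / |x|]. *)
Lemma Cmod_Re_test (x : C) (M : R) : 0 <= M ->
  (forall c : C, Cmod c <= 1 -> Re (c * x)%C <= M) -> Cmod x <= M.
Proof.
  intros HM H. destruct (Req_dec (Cmod x) 0) as [E|E]. lra.
  pose proof (Cmod_ge_0 x).
  specialize (H (Cconj x / Cmod x)%C).
  assert (Hne : RtoC (Cmod x) <> 0). { intros E'. apply E. apply RtoC_inj in E'. exact E'. }
  rewrite Cmod_div, Cmod_conj, Cmod_R, Rabs_pos_eq in H by auto.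
  replace (Cconj x / Cmod x * x)%C with (RtoC (Cmod x)) in H.
  simpl in H. apply H. right. field. exact E.
  replace (Cconj x / Cmod x * x)%C with (x * Cconj x / Cmod x)%C by (field; auto).
  rewrite <- Cmod2_conj, RtoC_pow. field. auto.
Qed.

Lemma complex_mean_value_ineq (f f1 : C -> C) (a b : C) (M : R) : 0 <= M ->
  (forall t : R, 0 <= t <= 1 -> cder f (a + t * (b - a))%C (f1 (a + t * (b - a))%C) /\
      Cmod (f1 (a + t * (b - a))%C) <= M) ->
  Cmod (f b - f a) <= M * Cmod (b - a).
Proof.
  intros HM H. apply Cmod_Re_test.
  apply Rmult_le_pos; [exact HM|apply Cmod_ge_0].
  intros c Hc.
  destruct (complex_mvt f f1 a b c) as [t [Ht E]].
  { intros t Ht; apply H; exact Ht. }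
  rewrite E. eapply Rle_trans. apply Rle_abs. eapply Rle_trans. apply re_le_Cmod.
  rewrite !Cmod_mult. destruct (H t Ht) as [_ Hm].
  pose proof (Cmod_ge_0 c). pose proof (Cmod_ge_0 (b - a)).
  pose proof (Cmod_ge_0 (f1 (a + t * (b - a))%C)).
  set (X := Cmod (f1 (a + t * (b - a))%C)) in *.
  assert (X * Cmod (b - a) <= M * Cmod (b-a)) by nra.
  assert (0 <= X * Cmod (b - a)) by nra. nra.
Qed.

Lemma disc_segment (a b : C) (r t : R) : Cmod a < r -> Cmod b < r -> 0 <= t <= 1 ->
  Cmod (a + t * (b - a)) < r.
Proof.
  intros Ha Hb Ht.
  replace (a + t * (b - a))%C with ((1 - t)%R * a + t * b)%C by (rewrite RtoC_minus; ring).
  eapply Rle_lt_trans. apply Cmod_triangle. rewrite !Cmod_mult, !Cmod_R.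
  rewrite !Rabs_pos_eq by lra.
  pose proof (Cmod_ge_0 a). pose proof (Cmod_ge_0 b).
  set (A := Cmod a) in *. set (B := Cmod b) in *.
  destruct (Req_dec t 1) as [->|Ht1]; nra.
Qed.

Lemma disc_zero_derivative (f : C -> C) :
  (forall z, Cmod z < 1 -> cder f z 0) -> forall z, Cmod z < 1 -> f z = f 0.
Proof.
  intros H z Hz. apply Ceq_minus. apply Cmod_eq_0. apply Rle_antisym; [|apply Cmod_ge_0].
  apply Rle_trans with (0 * Cmod (z - 0)); [|lra].
  apply (complex_mean_value_ineq f (fun _ => RtoC 0)). lra.
  intros t Ht. split. apply H. apply disc_segment; auto. rewrite Cmod_0; lra.
  rewrite Cmod_0; lra.
Qed.

Lemma Cexp_plus (a b : C) : Cexp (a + b) = (Cexp a * Cexp b)%C.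
Proof.
  destruct a as [x y], b as [u v]. unfold Cexp. simpl.
  rewrite exp_plus, cos_plus, sin_plus.
  unfold Cmult; simpl. f_equal; ring.
Qed.

Lemma Cexp_0 : Cexp 0 = 1.
Proof.
  unfold Cexp; simpl. rewrite exp_0, cos_0, sin_0. unfold Cmult; simpl.
  apply injective_projections; simpl; ring.
Qed.

Lemma Cexp_neq_0 (z : C) : Cexp z <> 0.
Proof.
  intros E. assert (H : (Cexp z * Cexp (- z) = 1)%C).
  { rewrite <- Cexp_plus. replace (z + - z)%C with (RtoC 0) by ring. apply Cexp_0. }
  rewrite E in H. apply C1_nz. rewrite <- H. ring.
Qed.

Lemma Cmod_Cexp (z : C) : Cmod (Cexp z) = exp (Re z).
Proof.
  unfold Cexp. rewrite Cmod_mult, Cmod_R, Rabs_pos_eq by (left; apply exp_pos).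
  unfold Cmod at 1. simpl.
  replace (cos (Im z) * (cos (Im z) * 1) + sin (Im z) * (sin (Im z) * 1))
    with (Rsqr (sin (Im z)) + Rsqr (cos (Im z))) by (unfold Rsqr; ring).
  rewrite sin2_cos2, sqrt_1. ring.
Qed.

Lemma im_le_Cmod (z : C) : Rabs (Im z) <= Cmod z.
Proof. eapply Rle_trans; [|apply Rmax_Cmod]. apply Rmax_r. Qed.

Lemma Cmod_le_ReIm (z : C) : Cmod z <= Rabs (Re z) + Rabs (Im z).
Proof.
  replace z with (RtoC (Re z) + Ci * RtoC (Im z))%C at 1.
  eapply Rle_trans. apply Cmod_triangle. rewrite Cmod_mult, Cmod_Ci, !Cmod_R. lra.
  destruct z; unfold Cplus, Cmult, RtoC, Ci; simpl. f_equal; ring.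
Qed.

Lemma real_deriv_eps (f : R -> R) (l : R) (H : is_derive f 0 l) (eps : R) : 0 < eps ->
  exists d, 0 < d /\ forall x, Rabs x < d -> Rabs (f x - f 0 - l * x) <= eps * Rabs x.
Proof.
  intros He. destruct H as [_ H].
  specialize (H 0 (fun P HP => HP) (mkposreal eps He)).
  destruct H as [d Hd]. exists d. split. apply cond_pos.
  intros x Hx.
  assert (Hb : ball 0 d x).
  { unfold ball; simpl. unfold AbsRing_ball, minus, plus, opp, abs; simpl.
    replace (x + - 0) with x by ring. exact Hx. }
  specialize (Hd x Hb).
  unfold norm, minus, plus, opp, scal in Hd; simpl in Hd. unfold mult, abs in Hd; simpl in Hd.
  replace (x + - 0) with x in Hd by ring.
  replace (f x - f 0 - l * x) with (f x + - f 0 + - (x * l)) by ring. exact Hd.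
Qed.

(** The only analytic input about the exponential; the addition formula carries it to every
    point. *)
Lemma cder_Cexp_0 : cder Cexp 0 1.
Proof.
  apply cder_eps. intros eps He.
  assert (He' : 0 < Rmin (eps/16) 1) by (apply Rmin_pos; lra).
  destruct (real_deriv_eps exp 1) with (eps := Rmin (eps/16) 1) as [d1 [Hd1 H1]]; [|exact He'|].
  { replace 1 with (exp 0) by apply exp_0. apply is_derive_Reals. apply derivable_pt_lim_exp. }
  destruct (real_deriv_eps sin 1) with (eps := Rmin (eps/16) 1) as [d2 [Hd2 H2]]; [|exact He'|].
  { replace 1 with (cos 0) by apply cos_0. apply is_derive_Reals. apply derivable_pt_lim_sin. }
  destruct (real_deriv_eps cos 0) with (eps := Rmin (eps/16) 1) as [d3 [Hd3 H3]]; [|exact He'|].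
  { replace 0 with (- sin 0) at 2 by (rewrite sin_0; ring).
    apply is_derive_Reals. apply derivable_pt_lim_cos. }
  set (d := Rmin (Rmin d1 d2) (Rmin d3 (Rmin (eps / 16) 1))).
  assert (Hd : 0 < d) by (unfold d; repeat apply Rmin_pos; lra).
  exists d. split. exact Hd. intros w Hw.
  assert (Hm : d <= d1 /\ d <= d2 /\ d <= d3 /\ d <= eps/16 /\ d <= 1).
  { unfold d. pose proof (Rmin_l (Rmin d1 d2) (Rmin d3 (Rmin (eps / 16) 1))).
    pose proof (Rmin_r (Rmin d1 d2) (Rmin d3 (Rmin (eps / 16) 1))).
    pose proof (Rmin_l d1 d2). pose proof (Rmin_r d1 d2).
    pose proof (Rmin_l d3 (Rmin (eps / 16) 1)). pose proof (Rmin_r d3 (Rmin (eps / 16) 1)).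
    pose proof (Rmin_l (eps/16) 1). pose proof (Rmin_r (eps/16) 1). lra. }
  replace (w - 0)%C with w in * by ring.
  rewrite Cexp_0.
  destruct w as [x y].
  pose proof (re_le_Cmod (x, y)) as Hx. pose proof (im_le_Cmod (x, y)) as Hy. simpl in Hx, Hy.
  set (m := Cmod (x, y)) in *.
  specialize (H1 x ltac:(lra)). specialize (H2 y ltac:(lra)). specialize (H3 y ltac:(lra)).
  rewrite exp_0 in H1. rewrite sin_0 in H2. rewrite cos_0 in H3.
  pose proof (Rmin_l (eps/16) 1) as Hl. pose proof (Rmin_r (eps/16) 1) as Hr.
  set (e := Rmin (eps/16) 1) in *.
  assert (Hm0 : 0 <= m) by apply Cmod_ge_0.
  eapply Rle_trans. apply Cmod_le_ReIm. unfold Cexp. simpl.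
  (* With exp x = 1 + x + E, sin y = y + S and cos y = 1 + K, the error term is a sum of
     at most nine monomials, each of them at most (eps / 16) * m. *)
  set (E := exp x - 1 - 1 * x) in *.
  set (S := sin y - 0 - 1 * y) in *.
  set (K := cos y - 1 - 0 * y) in *.
  replace (exp x) with (1 + x + E) by (unfold E; ring).
  replace (cos y) with (1 + K) by (unfold K; ring).
  replace (sin y) with (y + S) by (unfold S; ring).
  assert (HE : Rabs E <= e * m) by nra.
  assert (HS : Rabs S <= e * m) by nra.
  assert (HK : Rabs K <= e * m) by nra.
  apply Rabs_le_between in HE. apply Rabs_le_between in HS. apply Rabs_le_between in HK.
  apply Rabs_le_between in Hx. apply Rabs_le_between in Hy.
  assert (Hem : e * m <= eps / 16 * m) by nra.
  assert (Hem1 : e * m <= m) by nra.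
  assert (m * m <= eps / 16 * m) by nra.
  assert (A1 : Rabs E <= e * m) by (apply Rabs_le; lra).
  assert (A2 : Rabs S <= e * m) by (apply Rabs_le; lra).
  assert (A3 : Rabs K <= e * m) by (apply Rabs_le; lra).
  assert (A4 : Rabs x <= m) by (apply Rabs_le; lra).
  assert (A5 : Rabs y <= m) by (apply Rabs_le; lra).
  assert (P1 : forall a b, Rabs a <= m -> Rabs b <= m -> Rabs (a * b) <= eps / 16 * m).
  { intros a b Ha Hb. rewrite Rabs_mult. pose proof (Rabs_pos a). pose proof (Rabs_pos b). nra. }
  assert (Q1 := P1 x K A4 ltac:(lra)). assert (Q2 := P1 E K ltac:(lra) ltac:(lra)).
  assert (Q3 := P1 x y A4 A5). assert (Q4 := P1 x S A4 ltac:(lra)).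
  assert (Q5 := P1 E y ltac:(lra) A5). assert (Q6 := P1 E S ltac:(lra) ltac:(lra)).
  apply Rabs_le_between in Q1. apply Rabs_le_between in Q2. apply Rabs_le_between in Q3.
  apply Rabs_le_between in Q4. apply Rabs_le_between in Q5. apply Rabs_le_between in Q6.
  apply Rle_trans with (eps / 2 * m + eps / 2 * m); [|lra].
  apply Rplus_le_compat; apply Rabs_le; lra.
Qed.

Lemma cder_Cexp (z : C) : cder Cexp z (Cexp z).
Proof.
  apply (is_derive_ext (fun w => Cexp z * Cexp (w - z))%C).
  { intros w. rewrite <- Cexp_plus. f_equal. ring. }
  eapply cder_eq; [|apply cder_mult; [apply cder_const|apply cder_comp;
     [|apply cder_minus; [apply cder_id|apply cder_const]]]].
  2:{ replace (z - z)%C with (RtoC 0) by ring. apply cder_Cexp_0. }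
  simpl. ring.
Qed.

(** [hol n U f]: [f] has [n] successive complex derivatives on [U].  The recursion makes
    closure under the field operations a direct induction on [n]. *)
Fixpoint hol (n : nat) (U : C -> Prop) (f : C -> C) : Prop :=
  match n with
  | O => True
  | S m => exists f1, (forall z, U z -> cder f z (f1 z)) /\ hol m U f1
  end.

Lemma hol_pred (n : nat) (U : C -> Prop) : forall f : C -> C, hol (S n) U f -> hol n U f.
Proof.
  induction n as [|n IH]; intros f [f1 [H1 H2]]. exact I.
  exists f1. split. exact H1. apply IH. exact H2.
Qed.

Lemma hol_subset (n : nat) (U V : C -> Prop) : (forall z, V z -> U z) ->
  forall f, hol n U f -> hol n V f.
Proof.
  intros HV. induction n as [|n IH]; intros f H. exact I.
  destruct H as [f1 [H1 H2]]. exists f1. split; auto.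
Qed.

Lemma hol_const (n : nat) (U : C -> Prop) : forall c : C, hol n U (fun _ => c).
Proof.
  induction n as [|n IH]; intros c. exact I.
  exists (fun _ => RtoC 0). split; [|apply IH]. intros; apply cder_const.
Qed.

Lemma hol_id (n : nat) (U : C -> Prop) : hol n U (fun z => z).
Proof.
  destruct n. exact I.
  exists (fun _ => RtoC 1). split; [|apply hol_const]. intros; apply cder_id.
Qed.

Lemma hol_plus (n : nat) (U : C -> Prop) : forall f g : C -> C, hol n U f -> hol n U g ->
  hol n U (fun z => f z + g z)%C.
Proof.
  induction n as [|n IH]; intros f g Hf Hg. exact I.
  destruct Hf as [f1 [Hf1 Hf2]], Hg as [g1 [Hg1 Hg2]].
  exists (fun z => f1 z + g1 z)%C. split; [|apply IH; auto].
  intros. apply cder_plus; auto.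
Qed.

Lemma hol_mult (n : nat) (U : C -> Prop) : forall f g : C -> C, hol n U f -> hol n U g ->
  hol n U (fun z => f z * g z)%C.
Proof.
  induction n as [|n IH]; intros f g Hf Hg. exact I.
  pose proof (hol_pred _ _ _ Hf) as Hf'. pose proof (hol_pred _ _ _ Hg) as Hg'.
  destruct Hf as [f1 [Hf1 Hf2]], Hg as [g1 [Hg1 Hg2]].
  exists (fun z => f1 z * g z + f z * g1 z)%C. split; [|apply hol_plus; apply IH; auto].
  intros. apply cder_mult; auto.
Qed.

Lemma hol_opp (n : nat) (U : C -> Prop) : forall f : C -> C, hol n U f ->
  hol n U (fun z => - f z)%C.
Proof.
  induction n as [|n IH]; intros f Hf. exact I.
  destruct Hf as [f1 [Hf1 Hf2]].
  exists (fun z => - f1 z)%C. split; [|apply IH; auto].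
  intros. apply cder_opp; auto.
Qed.

Lemma hol_minus (n : nat) (U : C -> Prop) (f g : C -> C) : hol n U f -> hol n U g ->
  hol n U (fun z => f z - g z)%C.
Proof. intros. apply hol_plus; [|apply hol_opp]; auto. Qed.

Lemma hol_inv (n : nat) (U : C -> Prop) : forall f : C -> C, (forall z, U z -> f z <> 0) -> hol n U f ->
  hol n U (fun z => / f z)%C.
Proof.
  induction n as [|n IH]; intros f H0 Hf. exact I.
  pose proof (hol_pred _ _ _ Hf) as Hf'.
  destruct Hf as [f1 [Hf1 Hf2]].
  exists (fun z => - (f1 z * (/ f z * / f z)))%C. split.
  - intros z Hz.
    eapply cder_eq; [|apply (cder_comp Cinv f); [apply cder_inv; auto|apply Hf1; auto]].
    field. auto.
  - apply hol_opp, hol_mult; auto. apply hol_mult; auto.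
Qed.

Lemma hol_div (n : nat) (U : C -> Prop) (f g : C -> C) : (forall z, U z -> g z <> 0) ->
  hol n U f -> hol n U g -> hol n U (fun z => f z / g z)%C.
Proof. intros. apply hol_mult; [|apply hol_inv]; auto. Qed.

(** * The maximum principle *)

Lemma second_derivative_test (phi phi1 : R -> R) (l d : R) : 0 < d ->
  (forall t, Rabs t < d -> is_derive phi t (phi1 t)) -> is_derive phi1 0 l ->
  (forall t, Rabs t < d -> phi t <= phi 0) -> l <= 0.
Proof.
  intros Hd H1 H2 Hmax. apply Rnot_lt_le. intros Hl.
  destruct (real_deriv_eps phi1 l H2 (l / 2)) as [d2 [Hd2 He]]; [lra|].
  set (x := Rmin d d2 / 2).
  assert (Hm : 0 < Rmin d d2) by (apply Rmin_pos; lra).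
  assert (Hx : 0 < x) by (unfold x; lra).
  assert (Hxd : x < d) by (unfold x; pose proof (Rmin_l d d2); lra).
  assert (Hxd2 : x < d2) by (unfold x; pose proof (Rmin_r d d2); lra).
  destruct (Rle_lt_dec 0 (phi1 0)) as [Hs|Hs].
  - destruct (MVT_cor2 phi phi1 0 x Hx) as [c [E Hc]].
    { intros c Hc. apply is_derive_Reals. apply H1. apply Rabs_lt_between; lra. }
    specialize (He c). rewrite (Rabs_pos_eq c) in He by lra.
    specialize (He ltac:(lra)). apply Rabs_le_between in He.
    specialize (Hmax x). rewrite (Rabs_pos_eq x) in Hmax by lra. specialize (Hmax Hxd).
    assert (0 < phi1 c) by nra. nra.
  - destruct (MVT_cor2 phi phi1 (-x) 0) as [c [E Hc]]. lra.
    { intros c Hc. apply is_derive_Reals. apply H1. apply Rabs_lt_between; lra. }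
    specialize (He c). rewrite (Rabs_left c) in He by lra.
    specialize (He ltac:(lra)). apply Rabs_le_between in He.
    specialize (Hmax (-x)). rewrite (Rabs_left (-x)) in Hmax by lra. specialize (Hmax ltac:(lra)).
    assert (phi1 c < 0) by nra. nra.
Qed.

Lemma list_argmax (T : Type) (f : T -> R) (l : list T) : l <> nil ->
  exists t, In t l /\ forall t', In t' l -> f t' <= f t.
Proof.
  induction l as [|a l IH]; intros H. congruence.
  destruct l as [|b l].
  - exists a. split. left; auto. intros t' [->|[]]. lra.
  - destruct IH as [t [Ht Hm]]. congruence.
    destruct (Rle_lt_dec (f t) (f a)).
    + exists a. split. left; auto. intros t' [->|Ht']. lra. specialize (Hm t' Ht'). lra.
    + exists t. split. right; auto. intros t' [->|Ht']. lra. auto.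
Qed.

(** Upper semicontinuous functions on compact sets attain their maximum.  If none of the
    points of [K] were a maximum, each would have a neighbourhood on which [u] stays below
    some value [u q]; among the finitely many [q] of a finite subcover the one with the
    largest value contradicts itself. *)
Lemma compact_max (K : C -> Prop) (u : C -> R) (r : R) (p0 : C) : K p0 ->
  (forall z, K z -> Cmod z <= r) ->
  (forall z, ~ K z -> exists d, 0 < d /\ forall w, Cmod (w - z) < d -> ~ K w) ->
  (forall z, K z -> forall eps, 0 < eps ->
     exists d, 0 < d /\ forall w, Cmod (w - z) < d -> u w < u z + eps) ->
  exists p, K p /\ forall q, K q -> u q <= u p.
Proof.
  intros Hp0 Hb Hc Hu. apply NNPP. intros Hn.
  assert (H : forall p : C, exists dq : R * C, 0 < fst dq /\ K (snd dq) /\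
     forall w, K w -> Cmod (w - p) < fst dq -> u w < u (snd dq)).
  { intros p. destruct (classic (K p)) as [Hp|Hp].
    - assert (Hq : exists q, K q /\ u p < u q).
      { apply NNPP. intros Hq. apply Hn. exists p. split. exact Hp.
        intros q HKq. apply Rnot_lt_le. intros Hlt. apply Hq. exists q. auto. }
      destruct Hq as [q [HKq Hlt]].
      destruct (Hu p Hp (u q - u p)) as [d [Hd Hw]]. lra.
      exists (d, q). simpl. repeat split; auto. intros w _ Hwd. specialize (Hw w Hwd). lra.
    - destruct (Hc p Hp) as [d [Hd Hw]]. exists (d, p0). simpl. repeat split; auto.
      intros w HKw Hwd. exfalso. exact (Hw w Hwd HKw). }
  assert (H' : exists D : C -> R * C, forall p, 0 < fst (D p) /\ K (snd (D p)) /\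
     forall w, K w -> Cmod (w - p) < fst (D p) -> u w < u (snd (D p))).
  { exists (fun p => proj1_sig (constructive_indefinite_description _ (H p))).
    intros p. exact (proj2_sig (constructive_indefinite_description _ (H p))). }
  destruct H' as [D HD].
  (* Half the radius: the cover is by squares, and a square of half side d / 2 lies in the
     disc of radius d. *)
  set (dl := fun t : Compactness.Tn 2 R => let '(x, (y, _)) := t in
     mkposreal (fst (D (x, y)) / 2) (Rdiv_lt_0_compat _ 2 (proj1 (HD (x,y))) Rlt_0_2)).
  apply (compactness_list 2 (- r, (- r, tt)) (r, (r, tt)) dl).
  intros [l Hl].
  assert (Hin : forall w, K w -> exists t, In t l /\
     u w < u (snd (D (fst t, fst (snd t))))).
  { intros w Hw. destruct (Hl (fst w, (snd w, tt))) as [t [Ht [_ Hclose]]].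
    - pose proof (Hb w Hw) as Hbw. pose proof (re_le_Cmod w) as H1. pose proof (im_le_Cmod w) as H2.
      unfold Re, Im in *. simpl.
      apply Rabs_le_between in H1. apply Rabs_le_between in H2. lra.
    - exists t. split. exact Ht. apply HD. exact Hw.
      destruct t as [x [y []]]. simpl in Hclose |- *.
      eapply Rle_lt_trans. apply Cmod_le_ReIm. destruct w as [a b]. simpl in *.
      destruct Hclose as [h1 [h2 _]]. unfold Rminus in *. lra. }
  destruct (Hin p0 Hp0) as [t0 [Ht0 _]].
  destruct (list_argmax _ (fun t : Compactness.Tn 2 R => u (snd (D (fst t, fst (snd t))))) l) as [t [Ht Hmx]].
  { intros E. rewrite E in Ht0. exact Ht0. }
  destruct (Hin (snd (D (fst t, fst (snd t))))) as [t' [Ht' Hlt]]. apply HD.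
  specialize (Hmx t' Ht'). simpl in Hmx. lra.
Qed.

(** The real scalar product of the plane. *)
Definition dot (a b : C) : R := Re a * Re b + Im a * Im b.

Lemma rder_line_dot (f g : C -> C) (p d a b : C) (t : R) :
  cder f (p + t * d)%C a -> cder g (p + t * d)%C b ->
  is_derive (fun t : R => dot (f (p + t * d)%C) (g (p + t * d)%C)) t
    (dot (a * d) (g (p + t * d)%C) + dot (f (p + t * d)%C) (b * d)).
Proof.
  intros Hf Hg.
  assert (Hre : forall (h : C -> C) l, cder h (p + t * d)%C l ->
     is_derive (fun t : R => Re (h (p + t * d)%C)) t (Re (l * d))).
  { intros h l Hh. pose proof (rder_line h p d l 1 t Hh) as H.
    rewrite Cmult_1_l in H.
    refine (is_derive_ext _ _ _ _ _ H). intros s. cbv beta. rewrite Cmult_1_l. reflexivity. }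
  assert (Him : forall (h : C -> C) l, cder h (p + t * d)%C l ->
     is_derive (fun t : R => Im (h (p + t * d)%C)) t (Im (l * d))).
  { intros h l Hh. pose proof (rder_line h p d l (- Ci) t Hh) as H.
    assert (E : forall x : C, Re (- Ci * x)%C = Im x) by (intros [x y]; simpl; ring).
    rewrite E in H.
    refine (is_derive_ext _ _ _ _ _ H). intros s. cbv beta. apply E. }
  unfold dot.
  pose proof (is_derive_plus _ _ _ _ _
    (is_derive_mult _ _ _ _ _ (Hre f a Hf) (Hre g b Hg) Rmult_comm)
    (is_derive_mult _ _ _ _ _ (Him f a Hf) (Him g b Hg) Rmult_comm)) as H.
  cbv beta in H. unfold plus, mult in H; simpl in H.
  evar_last. exact H. simpl. ring.
Qed.

(** [eps |z|^2] has positive Laplacian; [eta ln |z|^2] is harmonic and is -oo at 0. *)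
Definition barrier (eps eta : R) (z : C) : R := eps * dot z z + eta * ln (dot z z).

Lemma dot_self (z : C) : dot z z = Cmod z ^ 2.
Proof. rewrite Cmod2_alt. unfold dot. ring. Qed.

Lemma dot_self_pos (z : C) : z <> 0 -> 0 < dot z z.
Proof. intros H. rewrite dot_self. apply pow_lt. apply Cmod_gt_0. exact H. Qed.

(** The second derivative test along the directions [1] and [i]: the two second derivatives
    add up to the Laplacian, where the terms in [g''] and in [ln] cancel and
    [4 |g'|^2 + 4 eps] remains. *)
Lemma no_interior_max (g g1 : C -> C) (g2 p : C) (eps eta d : R) : 0 < eps -> 0 < d ->
  d <= Cmod p ->
  (forall z, Cmod (z - p) < d -> cder g z (g1 z)) -> cder g1 p g2 ->
  ~ (forall z, Cmod (z - p) < d ->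
       dot (g z) (g z) + barrier eps eta z <= dot (g p) (g p) + barrier eps eta p).
Proof.
  intros Heps Hd Hdp Hg Hg1 Hmax.
  assert (Hnz : forall z, Cmod (z - p) < d -> z <> 0).
  { intros z Hz E. rewrite E in Hz. replace (0 - p)%C with (- p)%C in Hz by ring.
    rewrite Cmod_opp in Hz. lra. }
  assert (Hpp : Cmod (p - p) < d). { replace (p - p)%C with (RtoC 0) by ring. rewrite Cmod_0. exact Hd. }
  assert (Hp := dot_self_pos p (Hnz p Hpp)).
  assert (Hdir : forall e : C, Cmod e = 1 ->
     2 * (dot (g1 p * e) (g1 p * e) + dot (g p) (g2 * e * e)) + 2 * eps * dot e e
     + 2 * eta * ((dot e e * dot p p - dot p e * (2 * dot p e)) / (dot p p * dot p p)) <= 0).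
  { intros e He.
    set (L := fun t : R => (p + t * e)%C).
    set (phi := fun t : R => dot (g (L t)) (g (L t)) + (eps * dot (L t) (L t) + eta * ln (dot (L t) (L t)))).
    set (phi1 := fun t : R => 2 * dot (g (L t)) (g1 (L t) * e) + 2 * eps * dot (L t) e
                 + 2 * eta * (dot (L t) e / dot (L t) (L t))).
    assert (HL : forall t, Rabs t < d -> Cmod (L t - p) < d).
    { intros t Ht. unfold L. replace (p + t * e - p)%C with (t * e)%C by ring.
      rewrite Cmod_mult, He, Cmod_R. lra. }
    assert (HL0 : L 0 = p). { unfold L. ring. }
    assert (Hds : forall x y, dot x y = dot y x) by (intros; unfold dot; ring).
    assert (DL : forall t, is_derive (fun t => dot (L t) (L t)) t (2 * dot (L t) e)).
    { intros t. evar_last. apply (rder_line_dot (fun z => z) (fun z => z)); apply cder_id.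
      rewrite Cmult_1_l. rewrite (Hds e). fold (L t). ring. }
    assert (De : forall t, is_derive (fun t => dot (L t) e) t (dot e e)).
    { intros t. evar_last. apply (rder_line_dot (fun z => z) (fun z => e)).
      apply cder_id. apply cder_const. rewrite Cmult_1_l, Cmult_0_l.
      unfold dot; simpl; ring. }
    apply (second_derivative_test phi phi1 _ d Hd).
    - intros t Ht. specialize (HL t Ht).
      pose proof (dot_self_pos _ (Hnz _ HL)) as Hpos.
      assert (D1 : is_derive (fun t => dot (g (L t)) (g (L t))) t (2 * dot (g (L t)) (g1 (L t) * e))).
      { evar_last. apply rder_line_dot; apply Hg; exact HL.
        fold (L t). rewrite (Hds (g1 (L t) * e)%C). ring. }
      assert (D3 : is_derive (fun t => ln (dot (L t) (L t))) t (2 * (dot (L t) e / dot (L t) (L t)))).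
      { evar_last. apply (is_derive_comp ln). apply is_derive_Reals.
        apply derivable_pt_lim_ln. exact Hpos. apply DL.
        unfold scal; simpl; unfold mult; simpl. unfold Rdiv. ring. }
      unfold phi. evar_last.
      apply @is_derive_plus. exact D1. apply @is_derive_plus.
      apply is_derive_scal. apply DL. apply is_derive_scal. exact D3.
      unfold phi1, plus; simpl. ring.
    - assert (D1 : is_derive (fun t => dot (g (L t)) (g1 (L t) * e)) 0
         (dot (g1 p * e) (g1 p * e) + dot (g p) (g2 * e * e))).
      { evar_last. apply (rder_line_dot g (fun z => g1 z * e)%C).
        - fold (L 0). rewrite HL0. apply Hg. exact Hpp.
        - fold (L 0). rewrite HL0. apply cder_mult. exact Hg1. apply cder_const.
        - fold (L 0). rewrite HL0. rewrite Cmult_0_r, Cplus_0_r. reflexivity. }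
      assert (D3 : is_derive (fun t => dot (L t) e / dot (L t) (L t)) 0
        ((dot e e * dot p p - dot p e * (2 * dot p e)) / (dot p p * dot p p))).
      { evar_last. apply is_derive_div. apply De. apply DL. rewrite HL0. lra.
        simpl. rewrite !HL0. field. lra. }
      unfold phi1. evar_last.
      apply @is_derive_plus. apply @is_derive_plus.
      apply is_derive_scal. exact D1. apply is_derive_scal. apply De. apply is_derive_scal. exact D3.
      unfold plus; simpl. ring.
    - intros t Ht. unfold phi. rewrite HL0. apply (Hmax (L t)). apply HL. exact Ht. }
  assert (H1 := Hdir 1 Cmod_1). assert (H2 := Hdir Ci Cmod_Ci).
  assert (E : forall x y, (x * y - dot p 1 * (2 * dot p 1)) / (y * y) +
       (x * y - dot p Ci * (2 * dot p Ci)) / (y*y) = (2 * x * y - 2 * dot p p) / (y * y)).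
  { intros x y. unfold Rdiv. rewrite <- Rmult_plus_distr_r. f_equal. unfold dot; simpl. ring. }
  assert (E1 : dot 1 1 = 1) by (unfold dot; simpl; ring).
  assert (E2 : dot Ci Ci = 1) by (unfold dot; simpl; ring).
  rewrite E1 in H1. rewrite E2 in H2.
  specialize (E 1 (dot p p)).
  replace ((2 * 1 * dot p p - 2 * dot p p) / (dot p p * dot p p)) with 0 in E by (field; lra).
  assert (G : dot (g p) (g2 * 1 * 1) + dot (g p) (g2 * Ci * Ci) = 0).
  { destruct (g p), g2; unfold dot; simpl; ring. }
  assert (0 <= dot (g1 p * 1) (g1 p * 1)) by (unfold dot; nra).
  assert (0 <= dot (g1 p * Ci) (g1 p * Ci)) by (unfold dot; nra).
  apply (f_equal (Rmult eta)) in E. rewrite Rmult_plus_distr_l, Rmult_0_r in E.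
  lra.
Qed.

Notation punctured := (fun z : C => 0 < Cmod z < 1).

Lemma usc_test (g g1 : C -> C) (z : C) (eps eta : R) : z <> 0 -> cder g z (g1 z) ->
  forall e, 0 < e -> exists d, 0 < d /\ forall w, Cmod (w - z) < d ->
    dot (g w) (g w) + barrier eps eta w < dot (g z) (g z) + barrier eps eta z + e.
Proof.
  intros Hz Hg e He.
  set (U := AbsRing_UniformSpace C_AbsRing).
  assert (Hc : forall h l, cder h z l ->
     @continuous U R_UniformSpace (fun w => dot (h w) (h w)) z).
  { intros h l Hh. unfold dot.
    assert (Hcont : @continuous U C_UniformSpace h z).
    { apply (@ex_derive_continuous C_AbsRing C_NormedModule). exists l. exact Hh. }
    assert (Hre : @continuous U R_UniformSpace (fun w => Re (h w)) z).
    { apply (@continuous_comp U C_UniformSpace R_UniformSpace h Re). exact Hcont.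
      apply @continuous_fst. }
    assert (Him : @continuous U R_UniformSpace (fun w => Im (h w)) z).
    { apply (@continuous_comp U C_UniformSpace R_UniformSpace h Im). exact Hcont.
      apply @continuous_snd. }
    apply (@continuous_plus U R_AbsRing R_NormedModule).
    apply (@continuous_mult U R_AbsRing); auto.
    apply (@continuous_mult U R_AbsRing); auto. }
  assert (Hu : @continuous U R_UniformSpace (fun w => dot (g w) (g w) + barrier eps eta w) z).
  { unfold barrier. pose proof (Hc _ _ (cder_id z)) as Hid.
    apply (@continuous_plus U R_AbsRing R_NormedModule). apply (Hc _ _ Hg).
    apply (@continuous_plus U R_AbsRing R_NormedModule).
    apply (@continuous_scal_r U R_AbsRing R_NormedModule eps (fun w : C => dot w w)). exact Hid.
    apply (@continuous_scal_r U R_AbsRing R_NormedModule eta (fun w : C => ln (dot w w))).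
    apply (@continuous_comp U R_UniformSpace R_UniformSpace (fun w => dot w w) ln). exact Hid.
    apply (@ex_derive_continuous R_AbsRing R_NormedModule). exists (/ dot z z).
    apply is_derive_Reals. apply derivable_pt_lim_ln. apply dot_self_pos; exact Hz. }
  apply filterlim_locally with (eps := mkposreal e He) in Hu.
  destruct Hu as [d Hd]. exists d. split. apply cond_pos.
  intros w Hw. specialize (Hd w Hw). apply Rabs_lt_between in Hd.
  unfold minus, plus, opp in Hd; simpl in Hd. lra.
Qed.

(** The hypothesis [|z| |g z| <= 1] bounds [g] by [1/r] on the circle of radius [r], so by
    nearly 1 close to the unit circle.  If [|g z0| > 1], the function [|g|^2 + barrier] on a
    suitable annulus is larger at [z0] than on both boundary circles: on the outer one because
    the radius is close to 1, on the inner one because of the logarithm.  So it has an interior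
    maximum. *)
Lemma punctured_maximum_principle (g : C -> C) : hol 2 punctured g ->
  (exists d B, 0 < d /\ forall z, 0 < Cmod z < d -> Cmod (g z) <= B) ->
  (forall z, punctured z -> Cmod z * Cmod (g z) <= 1) ->
  forall z, punctured z -> Cmod (g z) <= 1.
Proof.
  intros [g1 [Hg1 [g2 [Hg2 _]]]] [d [B [Hd HB]]] Hbd z0 Hz0.
  apply Rnot_lt_le. intros Hgt.
  set (a := Cmod (g z0) ^ 2 - 1).
  assert (Ha : 0 < a) by (unfold a; nra).
  set (m2 := sqrt (/ (1 + a / 4))).
  assert (Hi : 0 < / (1 + a / 4) < 1).
  { split. apply Rinv_0_lt_compat; lra. rewrite <- Rinv_1. apply Rinv_lt_contravar; lra. }
  assert (Hm2 : 0 < m2 < 1).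
  { split. apply sqrt_lt_R0; lra. rewrite <- sqrt_1. apply sqrt_lt_1; lra. }
  assert (Hm2s : m2 * m2 = / (1 + a / 4)) by (apply sqrt_sqrt; lra).
  set (r := Rmax ((Cmod z0 + 1) / 2) m2).
  assert (Hr : Cmod z0 < r < 1).
  { unfold r. split. eapply Rlt_le_trans; [|apply Rmax_l]. lra. apply Rmax_lub_lt; lra. }
  assert (Hrm : m2 <= r) by apply Rmax_r.
  assert (Hlz : ln (dot z0 z0) < 0).
  { rewrite <- ln_1. rewrite dot_self. apply ln_increasing; nra. }
  (* eta is so small that the logarithm costs at most a / 4 at z0. *)
  set (eta := a / 4 / (1 - ln (dot z0 z0))).
  assert (Heta : 0 < eta) by (apply Rdiv_lt_0_compat; lra).
  assert (Hetaz : - (a / 4) <= eta * ln (dot z0 z0)).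
  { unfold eta. apply Rle_trans with (- (a / 4) * ((- ln (dot z0 z0)) / (1 - ln (dot z0 z0)))).
    2:{ right. field. lra. }
    assert ((- ln (dot z0 z0)) / (1 - ln (dot z0 z0)) <= 1) by (apply Rle_div_l; lra). nra. }
  (* The exponential makes |g|^2 + barrier at most 1 on the circle of radius s. *)
  set (s := Rmin (Rmin (d / 2) (Cmod z0 / 2)) (exp ((1 - B ^ 2 - a / 4) / eta / 2))).
  assert (Hs : 0 < s) by (unfold s; repeat apply Rmin_pos; try lra; apply exp_pos).
  assert (Hsd : s <= d / 2 /\ s <= Cmod z0 / 2 /\ s <= exp ((1 - B ^ 2 - a / 4) / eta / 2)).
  { unfold s. pose proof (Rmin_l (Rmin (d / 2) (Cmod z0 / 2)) (exp ((1 - B ^ 2 - a / 4) / eta / 2))).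
    pose proof (Rmin_r (Rmin (d / 2) (Cmod z0 / 2)) (exp ((1 - B ^ 2 - a / 4) / eta / 2))).
    pose proof (Rmin_l (d / 2) (Cmod z0 / 2)). pose proof (Rmin_r (d / 2) (Cmod z0 / 2)). lra. }
  assert (Hlns : ln s <= (1 - B ^ 2 - a / 4) / eta / 2).
  { rewrite <- (ln_exp ((1 - B ^ 2 - a / 4) / eta / 2)). apply ln_le; lra. }
  set (K := fun z : C => s <= Cmod z <= r).
  set (u := fun z => dot (g z) (g z) + barrier (a / 4) eta z).
  assert (Htri : forall z w : C, Cmod w <= Cmod z + Cmod (w - z) /\ Cmod z <= Cmod w + Cmod (w - z)).
  { intros z w. split.
    - replace w with (z + (w - z))%C at 1 by ring. apply Cmod_triangle.
    - replace z with (w + - (w - z))%C at 1 by ring. eapply Rle_trans. apply Cmod_triangle.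
      rewrite Cmod_opp. lra. }
  assert (HKp : forall z, K z -> punctured z) by (unfold K; intros z Hz; lra).
  destruct (compact_max K u r z0) as [p [HKp' Hp]].
  - unfold K. lra.
  - unfold K. intros; lra.
  - unfold K. intros z Hz. destruct (Rlt_le_dec (Cmod z) s) as [Hl|Hl].
    + exists (s - Cmod z). split. lra. intros w Hw. destruct (Htri z w). lra.
    + exists (Cmod z - r). assert (r < Cmod z) by (apply Rnot_le_lt; intros Hc; apply Hz; lra).
      split. lra. intros w Hw. destruct (Htri z w). lra.
  - intros z Hz e He. destruct (usc_test g g1 z (a / 4) eta) with (e := e) as [dd [Hdd Hw]].
    + apply Cmod_gt_0. apply HKp in Hz. lra.
    + apply Hg1. apply HKp, Hz.
    + exact He.
    + exists dd. split; auto.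
  - assert (Huz : 1 + a / 2 < u p).
    { apply Rlt_le_trans with (u z0); [|apply Hp; unfold K; lra].
      unfold u, barrier. rewrite (dot_self (g z0)).
      assert (0 < dot z0 z0) by (apply dot_self_pos; apply Cmod_gt_0; lra).
      unfold a in *. nra. }
    assert (Hup : u p = Cmod (g p) ^ 2 + (a / 4 * Cmod p ^ 2 + eta * (2 * ln (Cmod p)))).
    { unfold u, barrier. rewrite !dot_self. do 3 f_equal.
      replace (Cmod p ^ 2) with (Cmod p * Cmod p) by ring.
      rewrite ln_mult; [ring| |]; apply HKp in HKp'; lra. }
    pose proof (HKp p HKp') as Hpp. unfold K in HKp'.
    assert (Hp1 : Cmod p ^ 2 <= 1) by nra.
    assert (Hnr : Cmod p <> r).
    { intros E. specialize (Hbd p Hpp). rewrite E in *.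
      assert (ln r < 0). { rewrite <- ln_1. apply ln_increasing; lra. }
      assert (Hg : (r * r) * Cmod (g p) ^ 2 <= 1).
      { replace ((r * r) * Cmod (g p) ^ 2) with ((r * Cmod (g p)) * (r * Cmod (g p))) by ring.
        pose proof (Cmod_ge_0 (g p)). assert (0 <= r * Cmod (g p)) by nra. nra. }
      assert (Hrr : / (1 + a / 4) <= r * r) by (rewrite <- Hm2s; nra).
      assert (Cmod (g p) ^ 2 <= 1 + a / 4).
      { apply Rmult_le_reg_l with (/ (1 + a / 4)). lra. rewrite Rinv_l by lra.
        pose proof (pow2_ge_0 (Cmod (g p))). nra. }
      nra. }
    assert (Hns : Cmod p <> s).
    { intros E. assert (HBp := HB p ltac:(lra)). rewrite E in *.
      assert (eta * (2 * ln s) <= 1 - B ^ 2 - a / 4).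
      { apply (Rmult_le_compat_l eta) in Hlns; [|lra].
        replace (eta * ((1 - B ^ 2 - a / 4) / eta / 2)) with ((1 - B ^ 2 - a / 4) / 2) in Hlns by (field; lra).
        lra. }
      pose proof (Cmod_ge_0 (g p)). nra. }
    set (dd := Rmin s (Rmin (Cmod p - s) (r - Cmod p))).
    assert (Hdd : 0 < dd) by (unfold dd; repeat apply Rmin_pos; lra).
    assert (Hdd' : dd <= s /\ dd <= Cmod p - s /\ dd <= r - Cmod p).
    { unfold dd. pose proof (Rmin_l s (Rmin (Cmod p - s) (r - Cmod p))).
      pose proof (Rmin_r s (Rmin (Cmod p - s) (r - Cmod p))).
      pose proof (Rmin_l (Cmod p - s) (r - Cmod p)).
      pose proof (Rmin_r (Cmod p - s) (r - Cmod p)). lra. }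
    apply (no_interior_max g g1 (g2 p) p (a / 4) eta dd); try lra.
    + intros z Hz. apply Hg1. apply HKp. unfold K. destruct (Htri p z). lra.
    + apply Hg2. exact Hpp.
    + intros z Hz. apply Hp. unfold K. destruct (Htri p z). lra.
Qed.

(** * The Schwarz-Pick inequality for the second coefficient *)

Lemma Cmod_triangle_rev (a b : C) : Cmod a - Cmod b <= Cmod (a - b).
Proof.
  assert (H : Cmod a <= Cmod (a - b) + Cmod b).
  { replace a with ((a - b) + b)%C at 1 by ring. apply Cmod_triangle. }
  lra.
Qed.

(** The remainder has derivative [f1 z - f1 0 - f2 z = o(z)], so the mean value inequality on
    the segment from 0 gives [o(z^2)]. *)
Lemma taylor2 (f f1 : C -> C) (f2 : C) :
  (forall z, unit_disc z -> cder f z (f1 z)) -> cder f1 0 f2 ->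
  forall eps, 0 < eps -> exists d, 0 < d <= 1 /\ forall z, Cmod z < d ->
    Cmod (f z - f 0 - f1 0 * z - f2 / 2 * (z * z)) <= eps * (Cmod z * Cmod z).
Proof.
  intros H1 H2 eps He.
  rewrite cder_eps in H2. destruct (H2 eps He) as [d [Hd Hw]].
  exists (Rmin d 1). split. split. apply Rmin_pos; lra. apply Rmin_r.
  intros z Hz.
  assert (Hzd : Cmod z < d) by (eapply Rlt_le_trans; [exact Hz|apply Rmin_l]).
  assert (Hz1 : Cmod z < 1) by (eapply Rlt_le_trans; [exact Hz|apply Rmin_r]).
  pose proof (Cmod_ge_0 z) as Hz0.
  pose proof (complex_mean_value_ineq (fun w => f w - f1 0 * w - f2 / 2 * (w * w))%C
     (fun w => f1 w - f1 0 - f2 * w)%C 0 z (eps * Cmod z)) as Hm.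
  rewrite <- Rmult_assoc. replace (z - 0)%C with z in Hm by ring.
  match goal with |- Cmod ?a <= _ => match type of Hm with _ -> _ -> Cmod ?b <= _ =>
    replace a with b by ring end end.
  apply Hm. nra.
  intros t Ht. replace (0 + t * z)%C with (t * z)%C by ring.
  assert (Hle : Cmod (t * z) <= Cmod z).
  { rewrite Cmod_mult, Cmod_R, Rabs_pos_eq by lra. nra. }
  split.
  - eapply cder_eq; [|apply cder_minus; [apply cder_minus; [apply H1; unfold unit_disc; lra|
      apply cder_mult; [apply cder_const|apply cder_id]]|
      apply cder_mult; [apply cder_const|apply cder_mult; apply cder_id]]].
    cbv beta. field.
  - replace (f1 (t * z)%C - f1 0 - f2 * (t * z))%C
      with (f1 (t * z)%C - f1 0 - f2 * (t * z - 0))%C by ring.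
    eapply Rle_trans. apply Hw. replace (t * z - 0)%C with (t * z)%C by ring. lra.
    replace (t * z - 0)%C with (t * z)%C by ring. nra.
Qed.

Lemma punctured_nz (z : C) : punctured z -> z <> 0.
Proof. intros Hz. apply Cmod_gt_0. lra. Qed.

Lemma schwarz_lemma (w : C -> C) : hol 2 unit_disc w -> w 0 = 0 ->
  (forall z, unit_disc z -> Cmod (w z) <= 1) ->
  forall z, unit_disc z -> Cmod (w z) <= Cmod z.
Proof.
  intros Hh H0 Hb z Hz.
  destruct (Req_dec (Cmod z) 0) as [E|E].
  { apply Cmod_eq_0 in E. rewrite E, H0. lra. }
  pose proof (Cmod_ge_0 z). unfold unit_disc in Hz.
  assert (H1 : Cmod (w z / z) <= 1).
  { apply (punctured_maximum_principle (fun z => w z / z)%C); [| | |lra].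
    - apply hol_div. apply punctured_nz. 
      apply (hol_subset 2 unit_disc); [|exact Hh]. unfold unit_disc. intros; lra. apply hol_id.
    - destruct Hh as [w1 [Hw1 _]]. specialize (Hw1 0).
      rewrite cder_eps in Hw1. destruct (Hw1 ltac:(unfold unit_disc; rewrite Cmod_0; lra) 1 Rlt_0_1) as [d [Hd Hw]].
      exists d, (1 + Cmod (w1 0)). split. exact Hd. intros y Hy.
      specialize (Hw y). rewrite H0 in Hw.
      replace (y - 0)%C with y in Hw by ring. specialize (Hw ltac:(lra)).
      assert (Hy0 : y <> 0) by (apply Cmod_gt_0; lra).
      rewrite Cmod_div by exact Hy0. apply Rle_div_l. lra.
      pose proof (Cmod_triangle_rev (w y - 0) (w1 0 * y)) as Ht.
      replace (w y - 0)%C with (w y) in * by ring. rewrite Cmod_mult in Ht. lra.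
    - intros y Hy. rewrite <- Cmod_mult.
      replace (y * (w y / y))%C with (w y) by (field; apply punctured_nz; exact Hy).
      apply Hb. unfold unit_disc. lra. }
  rewrite Cmod_div in H1 by (apply Cmod_gt_0; lra).
  apply Rle_div_l in H1; lra.
Qed.

(** The difference of the squares of the two sides is [(1 - |a|^2) (|z|^2 - |b|^2)]. *)
Lemma moebius_bound (a b z : C) : Cmod b <= Cmod z -> Cmod a <= 1 ->
  Cmod (b - a * z) <= Cmod (z - Cconj a * b).
Proof.
  intros Hb Ha. apply Rsqr_incr_0_var; [|apply Cmod_ge_0].
  assert (E : forall x, Rsqr (Cmod x) = Re x ^ 2 + Im x ^ 2).
  { intros x. rewrite <- Cmod2_alt. unfold Rsqr. ring. }
  assert (H1 := Rsqr_incr_1 _ _ Hb (Cmod_ge_0 _) (Cmod_ge_0 _)).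
  assert (H2 := Rsqr_incr_1 _ _ Ha (Cmod_ge_0 _) Rle_0_1).
  rewrite E in *. rewrite E in *. rewrite Rsqr_1 in H2.
  destruct a as [a1 a2], b as [b1 b2], z as [z1 z2]. simpl in *.
  assert (0 <= (1 - (a1^2 + a2^2)) * ((z1^2 + z2^2) - (b1^2 + b2^2))).
  { apply Rmult_le_pos; simpl; lra. }
  simpl in *. nra.
Qed.

(** Apply the maximum principle to [(v - a z) / (z (z - conj a v))] with [v = s w] and
    [a = s c1]; its value at 0 would be [s c2 / (1 - s^2 |c1|^2)].  The factor [s < 1] keeps
    the denominator away from 0 in the case [|c1| = 1], and tends to 1 at the end. *)
Lemma schwarz_pick_coefficient (w w1 : C -> C) (w2 : C) : hol 2 unit_disc w ->
  (forall z, unit_disc z -> cder w z (w1 z)) -> cder w1 0 w2 -> w 0 = 0 ->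
  (forall z, unit_disc z -> Cmod (w z) <= 1) ->
  Cmod (w2 / 2) <= 1 - Cmod (w1 0) ^ 2.
Proof.
  intros Hh Hw1 Hw2 H0 Hb.
  pose proof (schwarz_lemma w Hh H0 Hb) as Hsch.
  pose proof (taylor2 w w1 w2 Hw1 Hw2) as HT. rewrite H0 in HT.
  set (c1 := w1 0) in *. set (c2 := (w2 / 2)%C) in *.
  pose proof (Cmod_ge_0 c1) as Hc1p. pose proof (Cmod_ge_0 c2) as Hc2p.
  assert (Hc1 : Cmod c1 <= 1).
  { apply Rnot_lt_le. intros Hgt.
    destruct (HT 1 Rlt_0_1) as [d [Hd Hz]].
    set (t := Rmin (d / 2) ((Cmod c1 - 1) / (2 * (Cmod c2 + 1)))).
    assert (Ht : 0 < t).
    { apply Rmin_pos. lra. apply Rdiv_lt_0_compat; lra. }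
    assert (Ht1 : t <= d / 2) by apply Rmin_l.
    assert (Ht2 : t <= (Cmod c1 - 1) / (2 * (Cmod c2 + 1))) by apply Rmin_r.
    apply Rle_div_r in Ht2; [|lra].
    assert (Hmt : Cmod t = t) by (rewrite Cmod_R; apply Rabs_pos_eq; lra).
    specialize (Hz t). rewrite Hmt in Hz. specialize (Hz ltac:(lra)).
    specialize (Hsch t). unfold unit_disc in Hsch. rewrite Hmt in Hsch. specialize (Hsch ltac:(lra)).
    pose proof (Cmod_triangle_rev (c1 * t) (w t - c2 * (t * t))) as H1.
    pose proof (Cmod_triangle (w t) (- (c2 * (t * t)))) as H2.
    rewrite Cmod_opp, !Cmod_mult, Hmt in H2. rewrite Cmod_mult, Hmt in H1.
    replace (c1 * t - (w t - c2 * (t * t)))%C with (- (w t - 0 - c1 * t - c2 * (t * t)))%C in H1 by ring.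
    rewrite Cmod_opp in H1.
    replace (w t + - (c2 * (t * t)))%C with (w t - c2 * (t * t))%C in H2 by ring.
    assert (Cmod c1 * t <= t + Cmod c2 * (t * t) + 1 * (t * t)) by lra.
    assert (Cmod c1 <= 1 + (Cmod c2 + 1) * t).
    { apply Rmult_le_reg_r with t. exact Ht. lra. }
    nra. }
  assert (Hs : forall s, 0 < s < 1 -> s * Cmod c2 <= 1 - s ^ 2 * Cmod c1 ^ 2).
  { intros s Hs.
    set (a := (s * c1)%C).
    assert (Hms : Cmod s = s) by (rewrite Cmod_R; apply Rabs_pos_eq; lra).
    assert (Ha : Cmod a <= s). { unfold a. rewrite Cmod_mult, Hms. nra. }
    pose proof (Cmod_ge_0 a) as Ha0.
    assert (Hden : forall z, punctured z -> (1 - s) * Cmod z <= Cmod (z - Cconj a * (s * w z))).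
    { intros z Hz. eapply Rle_trans; [|apply Cmod_triangle_rev].
      rewrite !Cmod_mult, Cmod_conj, Hms. specialize (Hsch z). unfold unit_disc in Hsch.
      specialize (Hsch ltac:(lra)). pose proof (Cmod_ge_0 (w z)).
      assert (s * Cmod (w z) <= Cmod z) by nra. assert (0 <= s * Cmod (w z)) by nra. nra. }
    assert (Hden0 : forall z, punctured z -> (z - Cconj a * (s * w z))%C <> 0).
    { intros z Hz. apply Cmod_gt_0. specialize (Hden z Hz). nra. }
    assert (HG : forall z, punctured z ->
       Cmod ((s * w z - a * z) / (z * (z - Cconj a * (s * w z))))%C <= 1).
    { apply (punctured_maximum_principle (fun z => (s * w z - a * z) / (z * (z - Cconj a * (s * w z))))%C).
      - assert (Hwp : hol 2 punctured w).
        { apply (hol_subset 2 unit_disc); [|exact Hh]. unfold unit_disc. intros; lra. }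
        assert (Hsw : hol 2 punctured (fun z => s * w z)%C) by (apply hol_mult; [apply hol_const|exact Hwp]).
        apply hol_div.
        + intros z Hz. apply Cmult_neq_0; [apply punctured_nz, Hz|apply Hden0, Hz].
        + apply hol_minus. exact Hsw. apply hol_mult. apply hol_const. apply hol_id.
        + apply hol_mult. apply hol_id. apply hol_minus. apply hol_id. apply hol_mult. apply hol_const. exact Hsw.
      - destruct (HT 1 Rlt_0_1) as [d [Hd Hz]]. exists d, ((1 + Cmod c2) / (1 - s)).
        split. lra. intros z Hzd. assert (Hzp : punctured z) by lra.
        rewrite Cmod_div by (apply Cmult_neq_0; [apply punctured_nz, Hzp|apply Hden0, Hzp]).
        rewrite Cmod_mult. specialize (Hden z Hzp). specialize (Hz z ltac:(lra)).
        assert (Hnum : Cmod (s * w z - a * z) <= (1 + Cmod c2) * (Cmod z * Cmod z)).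
        { replace (s * w z - a * z)%C with (s * ((w z - 0 - c1 * z - c2 * (z * z)) + c2 * (z * z)))%C
            by (unfold a; ring).
          rewrite Cmod_mult, Hms.
          pose proof (Cmod_triangle (w z - 0 - c1 * z - c2 * (z * z)) (c2 * (z * z))) as Ht.
          rewrite (Cmod_mult c2), Cmod_mult in Ht.
          pose proof (Cmod_ge_0 (w z - 0 - c1 * z - c2 * (z * z) + c2 * (z * z))). nra. }
        apply Rle_div_l. { assert (0 < (1 - s) * Cmod z) by nra. nra. }
        apply Rle_trans with ((1 + Cmod c2) / (1 - s) * (Cmod z * ((1 - s) * Cmod z))).
        { eapply Rle_trans. exact Hnum. right. field. lra. }
        apply Rmult_le_compat_l. { apply Rdiv_le_0_compat; lra. }
        apply Rmult_le_compat_l; lra.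
      - intros z Hz. rewrite <- Cmod_mult.
        replace (z * ((s * w z - a * z) / (z * (z - Cconj a * (s * w z)))))%C
          with ((s * w z - a * z) / (z - Cconj a * (s * w z)))%C
          by (field; split; [apply Hden0, Hz|apply punctured_nz, Hz]).
        rewrite Cmod_div by (apply Hden0, Hz).
        apply Rle_div_l. apply Cmod_gt_0, Hden0, Hz. rewrite Rmult_1_l.
        apply moebius_bound; [|lra]. rewrite Cmod_mult, Hms.
        specialize (Hsch z). unfold unit_disc in Hsch. specialize (Hsch ltac:(lra)).
        pose proof (Cmod_ge_0 (w z)). nra. }
    apply Rnot_lt_le. intros Hgt.
    set (D := s * Cmod c2 - (1 - s ^ 2 * Cmod c1 ^ 2)).
    assert (HD : 0 < D) by (unfold D; lra).
    destruct (HT (D / 4)) as [d [Hd Hz]]. lra.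
    (* The values at a small real point t stand for the limit at 0: the Taylor remainder
       and the terms of order t cost at most D / 4 each. *)
    set (t := Rmin (d / 2) (D / 4 / (Cmod c2 + D / 4))).
    assert (Ht : 0 < t). { apply Rmin_pos. lra. apply Rdiv_lt_0_compat; lra. }
    assert (Ht1 : t <= d / 2) by apply Rmin_l.
    assert (Ht2 : t <= D / 4 / (Cmod c2 + D / 4)) by apply Rmin_r.
    apply Rle_div_r in Ht2; [|lra].
    assert (Hmt : Cmod t = t) by (rewrite Cmod_R; apply Rabs_pos_eq; lra).
    assert (Htp : punctured t) by (rewrite Hmt; lra).
    specialize (Hz t). rewrite Hmt in Hz. specialize (Hz ltac:(lra)).
    specialize (HG t Htp).
    rewrite Cmod_div in HG by (apply Cmult_neq_0; [apply punctured_nz, Htp|apply Hden0, Htp]).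
    apply Rle_div_l in HG; [|apply Cmod_gt_0, Cmult_neq_0; [apply punctured_nz, Htp|apply Hden0, Htp]].
    rewrite Rmult_1_l, Cmod_mult, Hmt in HG.
    set (Q := (w t - 0 - c1 * t - c2 * (t * t))%C) in *.
    pose proof (Cmod_ge_0 Q) as HQ0.
    assert (HL : s * (Cmod c2 * (t * t) - Cmod Q) <= Cmod (s * w t - a * t)).
    { replace (s * w t - a * t)%C with (s * (c2 * (t * t) - - Q))%C by (unfold a, Q; ring).
      rewrite Cmod_mult, Hms. apply Rmult_le_compat_l. lra.
      pose proof (Cmod_triangle_rev (c2 * (t * t)) (- Q)) as H1.
      rewrite Cmod_opp, !Cmod_mult, Hmt in H1. exact H1. }
    assert (HR : Cmod (t - Cconj a * (s * w t)) <= t * (1 - s ^ 2 * Cmod c1 ^ 2) + (Cmod c2 * (t * t) + Cmod Q)).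
    { replace (t - Cconj a * (s * w t))%C with
        (t * (1 - s ^ 2 * Cmod c1 ^ 2)%R + - (s * s * Cconj c1 * (c2 * (t * t) + Q)))%C.
      2:{ rewrite RtoC_minus, RtoC_mult, Cmod2_conj. unfold a, Q. rewrite Cmult_conj, RtoC_pow.
          replace (Cconj s) with (RtoC s). ring.
          unfold Cconj, RtoC; simpl. f_equal. ring. }
      eapply Rle_trans. apply Cmod_triangle.
      rewrite Cmod_opp, !Cmod_mult, Hms, Hmt, Cmod_conj, Cmod_R.
      assert (Hpos : 0 <= 1 - s ^ 2 * Cmod c1 ^ 2). { assert (s * Cmod c1 <= 1) by nra. assert (0 <= s * Cmod c1) by nra. nra. }
      rewrite Rabs_pos_eq by exact Hpos.
      apply Rplus_le_compat_l.
      pose proof (Cmod_triangle (c2 * (t * t)) Q) as H1. rewrite !Cmod_mult, Hmt in H1.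
      pose proof (Cmod_ge_0 (c2 * (t * t) + Q)) as H2.
      assert (s * s * Cmod c1 <= 1). { assert (s * s <= 1) by nra. assert (0 <= s * s) by nra. nra. }
      assert (0 <= s * s * Cmod c1) by (apply Rmult_le_pos; nra). nra. }
    apply (Rmult_le_compat_l t) in HR; [|lra].
    assert (Hfin : s * (Cmod c2 * (t * t) - D / 4 * (t * t)) <=
       t * (t * (1 - s ^ 2 * Cmod c1 ^ 2) + (Cmod c2 * (t * t) + D / 4 * (t * t)))) by nra.
    assert (Hfin2 : s * (Cmod c2 - D / 4) <= (1 - s ^ 2 * Cmod c1 ^ 2) + (Cmod c2 + D / 4) * t).
    { apply Rmult_le_reg_r with (t * t). nra. nra. }
    unfold D in *. nra. }
  apply Rnot_lt_le. intros Hgt.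
  set (x := Cmod c2) in *. set (y := Cmod c1 ^ 2) in *.
  assert (Hy : 0 <= y <= 1) by (unfold y; nra).
  (* s^2 (x + y) <= s x + s^2 y <= 1 forces x + y <= 1 as s tends to 1 *)
  set (q := / (x + y)).
  assert (Hq : 0 < q < 1).
  { unfold q. split. apply Rinv_0_lt_compat; lra. rewrite <- Rinv_1. apply Rinv_lt_contravar; lra. }
  specialize (Hs ((1 + q) / 2) ltac:(lra)).
  assert (Hqq : q * (x + y) = 1) by (unfold q; apply Rinv_l; lra).
  assert (q < ((1 + q) / 2) ^ 2) by nra.
  assert (((1 + q) / 2) ^ 2 * x <= (1 + q) / 2 * x) by nra.
  nra.
Qed.

(** * Power series on the unit disc *)

Definition csum (u : nat -> C) (l : C) : Prop := @is_series C_AbsRing C_NormedModule u l.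

(** Convergence is componentwise, which reduces complex series to real ones. *)
Lemma csum_iff (u : nat -> C) (l : C) :
  csum u l <-> is_series (fun n => Re (u n)) (Re l) /\ is_series (fun n => Im (u n)) (Im l).
Proof.
  set (M := NormedModule.AbelianMonoid C_AbsRing C_NormedModule).
  assert (HS : forall n, @sum_n M u n =
     ((sum_n (fun n => Re (u n)) n, sum_n (fun n => Im (u n)) n) : C)).
  { intros n. induction n as [|n IH].
    - rewrite !sum_O. unfold Re, Im. destruct (u O); reflexivity.
    - rewrite !sum_Sn, IH. reflexivity. }
  unfold csum, is_series. split.
  - intros H. apply (filterlim_ext _ _ HS) in H.
    split; apply filterlim_locally; intros eps;
    generalize (proj1 (filterlim_locally _ _) H eps); apply filter_imp;
    intros n [H1 H2]; assumption.
  - intros [H1 H2]. apply (filterlim_ext _ _ (fun n => eq_sym (HS n))).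
    apply filterlim_locally. intros eps.
    generalize (filter_and _ _ (proj1 (filterlim_locally _ _) H1 eps)
                  (proj1 (filterlim_locally _ _) H2 eps)).
    apply filter_imp. intros n [h1 h2]. split; assumption.
Qed.

Lemma csum_ext (u v : nat -> C) (l : C) : (forall n, u n = v n) -> csum u l -> csum v l.
Proof. intros H. apply is_series_ext. exact H. Qed.

Lemma csum_unique (u : nat -> C) (l m : C) : csum u l -> csum u m -> l = m.
Proof.
  rewrite !csum_iff. intros [H1 H2] [H3 H4].
  apply is_series_unique in H1, H2, H3, H4. apply injective_projections.
  exact (eq_trans (eq_sym H1) H3). exact (eq_trans (eq_sym H2) H4).
Qed.

Lemma csum_scal (c : C) (u : nat -> C) (l : C) : csum u l -> csum (fun n => c * u n)%C (c * l)%C.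
Proof. intros H. exact (is_series_scal_l c u l H). Qed.

Lemma csum_minus (u v : nat -> C) (l m : C) :
  csum u l -> csum v m -> csum (fun n => u n - v n)%C (l - m)%C.
Proof. intros H1 H2. exact (is_series_minus u v l m H1 H2). Qed.

Lemma csum_shift (u : nat -> C) (l : C) : csum (fun n => u (S n)) l -> csum u (l + u O)%C.
Proof.
  intros H. apply (@is_series_decr_1 C_AbsRing C_NormedModule).
  change (csum (fun k => u (S k)) (l + u O - u O)%C).
  replace (l + u O - u O)%C with l by ring. exact H.
Qed.

Lemma csum_abs (u : nat -> C) (b : nat -> R) : (forall n, Cmod (u n) <= b n) -> ex_series b ->
  exists l, csum u l.
Proof.
  intros Hb Hs.
  assert (H1 : ex_series (fun n => Re (u n))).
  { apply (@ex_series_le R_AbsRing R_CompleteNormedModule _ b); [|exact Hs]. intros n.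
    eapply Rle_trans; [apply re_le_Cmod|apply Hb]. }
  assert (H2 : ex_series (fun n => Im (u n))).
  { apply (@ex_series_le R_AbsRing R_CompleteNormedModule _ b); [|exact Hs]. intros n.
    eapply Rle_trans; [apply im_le_Cmod|apply Hb]. }
  destruct H1 as [l1 H1], H2 as [l2 H2]. exists (l1, l2). apply csum_iff. auto.
Qed.

(** The bound [v] of the partial sums is left free: it is the partial sum itself for a
    convergent majorant, and a constant when only a bound of the partial sums is known. *)
Lemma csum_bound (u : nat -> C) (l : C) (b v : nat -> R) (s : R) :
  csum u l -> (forall n, Cmod (u n) <= b n) -> (forall n, sum_n b n <= v n) ->
  is_lim_seq v s -> Cmod l <= s.
Proof.
  intros Hu Hb Hbv Hs.
  assert (Hlim : forall c : C, Cmod c <= 1 -> Re (c * l)%C <= s).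
  { intros c Hc. apply (csum_scal c) in Hu. apply csum_iff in Hu. destruct Hu as [Hu _].
    refine (is_lim_seq_le (sum_n (fun n => Re (c * u n)%C)) v (Re (c * l)%C) s _ Hu Hs).
    intros n. eapply Rle_trans; [|apply Hbv]. apply sum_n_m_le. intros k.
    eapply Rle_trans; [apply Rle_abs|]. eapply Rle_trans; [apply re_le_Cmod|].
    rewrite Cmod_mult. specialize (Hb k). pose proof (Cmod_ge_0 (u k)). nra. }
  apply Cmod_Re_test; [|exact Hlim].
  specialize (Hlim 0). rewrite Cmod_0, Cmult_0_l in Hlim. simpl in Hlim. apply Hlim. lra.
Qed.

Lemma csum_bounded (u : nat -> C) (l : C) : csum u l -> exists M, forall n, Cmod (u n) <= M.
Proof.
  intros H. apply csum_iff in H. destruct H as [H1 H2].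
  assert (HB : forall a : nat -> R, ex_series a -> exists M, forall n, Rabs (a n) <= M).
  { intros a Ha. apply ex_series_lim_0 in Ha.
    destruct (filterlim_bounded a (ex_intro _ 0 Ha)) as [M HM]. exists M. exact HM. }
  destruct (HB _ (ex_intro _ _ H1)) as [M1 HM1]. destruct (HB _ (ex_intro _ _ H2)) as [M2 HM2].
  exists (M1 + M2). intros n. eapply Rle_trans. apply Cmod_le_ReIm.
  apply Rplus_le_compat; auto.
Qed.

Definition disc_series (a : nat -> C) (F : C -> C) : Prop :=
  forall z, unit_disc z -> csum (fun n => z ^ n * a n)%C (F z).

Lemma pow_n_Cpow (z : C) (n : nat) : @pow_n C_Ring z n = (z ^ n)%C.
Proof. induction n as [|n IH]. reflexivity. simpl. rewrite IH. reflexivity. Qed.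

Lemma disc_series_pseries (a : nat -> C) (F : C -> C) :
  disc_series a F <->
  (forall z, unit_disc z -> @is_pseries C_AbsRing C_NormedModule a z (F z)).
Proof.
  split; intros H z Hz; specialize (H z Hz); unfold is_pseries in *;
  (eapply is_series_ext; [|exact H]); intros n; cbv beta; rewrite <- (pow_n_Cpow z n); reflexivity.
Qed.

(** Absolute convergence inside the disc, as a property of the coefficients alone. *)
Definition abs_disc (a : nat -> C) : Prop :=
  forall r, 0 <= r < 1 -> ex_series (fun n => Cmod (a n) * r ^ n).

Lemma abs_disc_of_bound (a : nat -> C) :
  (forall r, 0 < r < 1 -> exists M, forall n, Cmod (a n) * r ^ n <= M) -> abs_disc a.
Proof.
  intros H r Hr. destruct (H ((1 + r) / 2)) as [M HM]. lra.
  set (q := r / ((1 + r) / 2)).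
  assert (Hq : 0 <= q < 1).
  { unfold q. split. apply Rdiv_le_0_compat; lra. apply Rlt_div_l; lra. }
  apply (@ex_series_le R_AbsRing R_CompleteNormedModule _ (fun n => M * q ^ n)).
  - intros n. unfold norm; simpl. unfold abs; simpl.
    pose proof (Cmod_ge_0 (a n)). pose proof (pow_le r n (proj1 Hr)).
    rewrite Rabs_pos_eq by nra.
    replace (r ^ n) with (((1 + r) / 2) ^ n * q ^ n).
    2:{ rewrite <- Rpow_mult_distr. f_equal. unfold q. field. lra. }
    rewrite <- Rmult_assoc. apply Rmult_le_compat_r. apply pow_le; lra. apply HM.
  - apply (@ex_series_scal_l R_AbsRing R_NormedModule M (fun n => q ^ n)).
    apply ex_series_geom. rewrite Rabs_pos_eq; lra.
Qed.

Lemma disc_series_abs (a : nat -> C) (F : C -> C) : disc_series a F -> abs_disc a.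
Proof.
  intros H. apply abs_disc_of_bound. intros r Hr.
  assert (Hm : Cmod r = r) by (rewrite Cmod_R; apply Rabs_pos_eq; lra).
  destruct (csum_bounded _ _ (H r ltac:(unfold unit_disc; rewrite Hm; lra))) as [M HM].
  exists M. intros n. specialize (HM n).
  rewrite Cmod_mult, Cmod_pow, Hm in HM. lra.
Qed.

Lemma abs_disc_series (a : nat -> C) : abs_disc a -> exists F, disc_series a F.
Proof.
  intros H.
  assert (HF : forall z, exists l, unit_disc z -> csum (fun n => z ^ n * a n)%C l).
  { intros z. destruct (classic (unit_disc z)) as [Hz|Hz].
    - destruct (csum_abs (fun n => z ^ n * a n)%C (fun n => Cmod (a n) * Cmod z ^ n)) as [l Hl].
      + intros n. rewrite Cmod_mult, Cmod_pow. lra.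
      + apply H. unfold unit_disc in Hz. pose proof (Cmod_ge_0 z). lra.
      + exists l. auto.
    - exists (RtoC 0). intros; contradiction. }
  exists (fun z => proj1_sig (constructive_indefinite_description _ (HF z))).
  intros z Hz. exact (proj2_sig (constructive_indefinite_description _ (HF z)) Hz).
Qed.

Definition cderiv (a : nat -> C) (n : nat) : C := (INR (S n) * a (S n))%C.

Lemma abs_disc_radius (a : nat -> C) : abs_disc a ->
  forall r : R, r < 1 -> Rbar_lt r (CV_radius (fun n => Cmod (a n))).
Proof.
  intros H r Hr.
  set (r' := (1 + Rmax r 0) / 2).
  assert (Hm : Rmax r 0 < 1) by (apply Rmax_lub_lt; lra).
  assert (H1 : r < r') by (unfold r'; pose proof (Rmax_l r 0); lra).
  assert (H2 : 0 <= r' < 1) by (unfold r'; pose proof (Rmax_r r 0); lra).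
  apply Rbar_lt_le_trans with r'. exact H1.
  apply (proj1 (CV_radius_bounded (fun n => Cmod (a n)))).
  pose proof (ex_series_lim_0 _ (H r' H2)) as Hlim.
  destruct (filterlim_bounded (fun n => Cmod (a n) * r' ^ n) (ex_intro _ 0 Hlim)) as [M HM].
  exists M. exact HM.
Qed.

Lemma PS_derive_Cmod (a : nat -> C) (n : nat) :
  PS_derive (fun n => Cmod (a n)) n = Cmod (cderiv a n).
Proof.
  unfold PS_derive, cderiv. rewrite Cmod_mult, Cmod_R, Rabs_pos_eq. reflexivity. apply pos_INR.
Qed.

(** The real theorem on the radius of convergence of a derived series, applied to the
    moduli of the coefficients. *)
Lemma abs_disc_cderiv (a : nat -> C) : abs_disc a -> abs_disc (cderiv a).
Proof.
  intros H r Hr.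
  assert (HR := abs_disc_radius a H r (proj2 Hr)).
  rewrite <- CV_radius_derive in HR.
  rewrite <- (Rabs_pos_eq r) in HR by lra.
  apply CV_disk_inside in HR.
  eapply ex_series_ext; [|exact HR].
  intros n. cbv beta. rewrite PS_derive_Cmod. apply Rabs_pos_eq.
  apply Rmult_le_pos. apply Cmod_ge_0. apply pow_le; lra.
Qed.

(** Induction on [r_(m+1) = w r_m + m z^(m-1) (w - z)^2] for
    [r_m = w^m - z^m - m z^(m-1) (w - z)], starting from [r_2 = (w - z)^2]. *)
Lemma power_remainder (w z : C) (r : R) (n : nat) : Cmod w <= r -> Cmod z <= r ->
  Cmod (w ^ S (S n) - z ^ S (S n) - INR (S (S n)) * z ^ S n * (w - z)) <=
  INR (S (S n)) * INR (S n) / 2 * r ^ n * (Cmod (w - z) * Cmod (w - z)).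
Proof.
  intros Hw Hz. pose proof (Cmod_ge_0 w). pose proof (Cmod_ge_0 z).
  induction n as [|n IH].
  - replace (w ^ 2 - z ^ 2 - INR 2 * z ^ 1 * (w - z))%C with ((w - z) * (w - z))%C
      by (simpl; rewrite RtoC_plus; ring).
    rewrite Cmod_mult. simpl. right. field.
  - replace (w ^ S (S (S n)) - z ^ S (S (S n)) - INR (S (S (S n))) * z ^ S (S n) * (w - z))%C
      with (w * (w ^ S (S n) - z ^ S (S n) - INR (S (S n)) * z ^ S n * (w - z))
            + INR (S (S n)) * z ^ S n * ((w - z) * (w - z)))%C.
    2:{ rewrite (S_INR (S (S n))), RtoC_plus. simpl Cpow. ring. }
    eapply Rle_trans. apply Cmod_triangle.
    rewrite (Cmod_mult w), (Cmod_mult (INR (S (S n)) * z ^ S n)), (Cmod_mult (INR (S (S n)))), Cmod_pow.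
    rewrite Cmod_R, (Rabs_pos_eq (INR (S (S n)))) by apply pos_INR.
    rewrite (Cmod_mult (w - z)).
    set (D := Cmod (w - z) * Cmod (w - z)) in *.
    assert (HD : 0 <= D) by (unfold D; pose proof (Cmod_ge_0 (w - z)); nra).
    apply Rle_trans with (r * (INR (S (S n)) * INR (S n) / 2 * r ^ n * D) + INR (S (S n)) * r ^ S n * D).
    + apply Rplus_le_compat.
      * apply Rmult_le_compat; auto. apply Cmod_ge_0.
      * apply Rmult_le_compat_r. exact HD. apply Rmult_le_compat_l. apply pos_INR.
        apply pow_incr. lra.
    + right. rewrite (S_INR (S (S n))), (S_INR (S n)). simpl pow. field.
Qed.

(** Termwise differentiation: by [power_remainder] the error is at most [|w - z|^2 / 2] times
    the sum of the twice derived series of moduli at a radius [r > |z|]. *)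
Lemma disc_series_derivative (a : nat -> C) (F F1 : C -> C) :
  disc_series a F -> disc_series (cderiv a) F1 ->
  forall z, unit_disc z -> cder F z (F1 z).
Proof.
  intros HF HF1 z Hz. unfold unit_disc in Hz.
  set (r := (1 + Cmod z) / 2).
  pose proof (Cmod_ge_0 z) as Hz0.
  assert (Hr : Cmod z < r < 1) by (unfold r; lra).
  pose proof (abs_disc_cderiv _ (abs_disc_cderiv _ (disc_series_abs a F HF)) r ltac:(lra)) as [s Hs].
  assert (Hest : forall w, Cmod w <= r ->
     Cmod (F w - F z - F1 z * (w - z)) <= s / 2 * (Cmod (w - z) * Cmod (w - z))).
  { intros w Hw. set (D := Cmod (w - z) * Cmod (w - z)).
    (* The derived series with its index moved up by one, so that it can be subtracted term
       by term. *)
    set (v := fun n => match n with O => RtoC 0 | S k => ((w - z) * (z ^ k * cderiv a k))%C end).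
    assert (Hv : csum v (F1 z * (w - z))).
    { replace (F1 z * (w - z))%C with ((w - z) * F1 z + v O)%C by (simpl; ring).
      apply csum_shift. apply csum_scal. apply HF1. exact Hz. }
    pose proof (csum_minus _ _ _ _ (csum_minus _ _ _ _ (HF w ltac:(unfold unit_disc; lra)) (HF z Hz)) Hv) as Hu.
    set (b := fun n => match n with S (S k) => D / 2 * (Cmod (cderiv (cderiv a) k) * r ^ k) | _ => 0 end).
    apply (csum_bound _ _ b (sum_n b) _ Hu); [|intros; apply Rle_refl|].
    - intros [|[|n]]; unfold b, v.
      + replace (w ^ 0 * a 0%nat - z ^ 0 * a 0%nat - 0)%C with (RtoC 0) by (simpl; ring).
        rewrite Cmod_0. lra.
      + unfold cderiv. simpl INR.
        match goal with |- Cmod ?x <= 0 => replace x with (RtoC 0) by (simpl; ring) end.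
        rewrite Cmod_0. lra.
      + replace (w ^ S (S n) * a (S (S n)) - z ^ S (S n) * a (S (S n)) - (w - z) * (z ^ S n * cderiv a (S n)))%C
          with (a (S (S n)) * (w ^ S (S n) - z ^ S (S n) - INR (S (S n)) * z ^ S n * (w - z)))%C
          by (unfold cderiv; ring).
        rewrite Cmod_mult. unfold cderiv. rewrite !Cmod_mult, !Cmod_R.
        rewrite !Rabs_pos_eq by apply pos_INR.
        apply Rle_trans with (Cmod (a (S (S n))) * (INR (S (S n)) * INR (S n) / 2 * r ^ n * D)).
        * apply Rmult_le_compat_l. apply Cmod_ge_0. apply power_remainder; lra.
        * right. field.
    - replace (s / 2 * D) with (D / 2 * s) by field.
      assert (Hsc : is_series (fun k => D / 2 * (Cmod (cderiv (cderiv a) k) * r ^ k)) (D / 2 * s))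
        by exact (is_series_scal_l (D / 2) _ _ Hs).
      change (is_series b (D / 2 * s)). apply (is_series_decr_1 b). apply (is_series_decr_1 (fun k => b (S k))).
      unfold b. unfold plus, opp; simpl. replace (D / 2 * s + - 0 + - 0) with (D / 2 * s) by ring.
      exact Hsc. }
  assert (Hs0 : 0 <= s).
  { specialize (Hest r). rewrite Cmod_R, Rabs_pos_eq in Hest by lra.
    specialize (Hest (Rle_refl r)).
    pose proof (Cmod_ge_0 (F r - F z - F1 z * (r - z))).
    assert (0 < Cmod (r - z)).
    { apply Cmod_gt_0. intros E. apply Ceq_minus in E.
      assert (Hm : Cmod r = r) by (rewrite Cmod_R; apply Rabs_pos_eq; lra).
      rewrite E in Hm at 1. lra. }
    assert (0 < Cmod (r - z) * Cmod (r - z)) by nra. nra. }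
  apply cder_eps. intros eps He.
  exists (Rmin (r - Cmod z) (eps / (s + 1))). split.
  { apply Rmin_pos. lra. apply Rdiv_lt_0_compat; lra. }
  intros w Hw.
  assert (H1 := Rlt_le_trans _ _ _ Hw (Rmin_l _ _)).
  assert (H2 := Rlt_le_trans _ _ _ Hw (Rmin_r _ _)).
  apply Rlt_div_r in H2; [|lra].
  eapply Rle_trans. apply Hest.
  { replace w with ((w - z) + z)%C by ring. eapply Rle_trans. apply Cmod_triangle. lra. }
  pose proof (Cmod_ge_0 (w - z)).
  assert (s / 2 * Cmod (w - z) <= eps) by nra. nra.
Qed.

Lemma disc_series_hol (n : nat) : forall (a : nat -> C) (F : C -> C),
  disc_series a F -> hol n unit_disc F.
Proof.
  induction n as [|n IH]; intros a F HF. exact I.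
  destruct (abs_disc_series (cderiv a)) as [F1 HF1].
  { apply abs_disc_cderiv, (disc_series_abs a F HF). }
  exists F1. split. exact (disc_series_derivative a F F1 HF HF1). exact (IH _ _ HF1).
Qed.

Lemma disc_series_0 (a : nat -> C) (F : C -> C) : disc_series a F -> F 0 = a O.
Proof.
  intros H. specialize (H 0 ltac:(unfold unit_disc; rewrite Cmod_0; lra)).
  apply (csum_unique (fun n => 0 ^ n * a n)%C). exact H.
  apply (csum_ext (fun n => scal (@pow_n C_Ring (RtoC 0) n) (a n))).
  - intros n. rewrite <- (pow_n_Cpow (RtoC 0) n). reflexivity.
  - exact (@is_pseries_0 C_AbsRing C_NormedModule a).
Qed.

Definition rseries (a : nat -> R) (F : C -> C) : Prop := disc_series (fun n => RtoC (a n)) F.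

(** The real Cauchy product of the library, applied to the four products of real and
    imaginary parts of the terms. *)
Lemma rseries_mult (a b : nat -> R) (A B : C -> C) :
  rseries a A -> rseries b B ->
  rseries (fun n => sum_f_R0 (fun k => a k * b (n - k)%nat) n) (fun z => A z * B z)%C.
Proof.
  intros HA HB z Hz.
  pose proof (disc_series_abs _ _ HA) as HA'. pose proof (disc_series_abs _ _ HB) as HB'.
  specialize (HA z Hz). specialize (HB z Hz).
  assert (Habs : forall c : nat -> R, abs_disc (fun n => RtoC (c n)) ->
     ex_series (fun n => Rabs (Re (z ^ n * c n)%C)) /\ ex_series (fun n => Rabs (Im (z ^ n * c n)%C))).
  { intros c Hc. specialize (Hc (Cmod z) ltac:(unfold unit_disc in Hz; pose proof (Cmod_ge_0 z); lra)).
    split; (apply (@ex_series_le R_AbsRing R_CompleteNormedModule _ (fun n => Cmod (c n) * Cmod z ^ n)); [|exact Hc]);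
    intros n; match goal with |- norm ?x <= _ => change (norm x) with (Rabs x) end;
    rewrite Rabs_Rabsolu.
    - eapply Rle_trans. apply re_le_Cmod. rewrite Cmod_mult, Cmod_pow. lra.
    - eapply Rle_trans. apply im_le_Cmod. rewrite Cmod_mult, Cmod_pow. lra. }
  destruct (Habs a HA') as [A1 A2]. destruct (Habs b HB') as [B1 B2].
  apply csum_iff in HA. apply csum_iff in HB. destruct HA as [HA1 HA2], HB as [HB1 HB2].
  assert (Hterm : forall (n k : nat), (k <= n)%nat ->
    (z ^ n * RtoC (a k * b (n - k)%nat))%C = ((z ^ k * a k) * (z ^ (n - k) * b (n - k)%nat))%C).
  { intros n k Hk. rewrite RtoC_mult. replace n with (k + (n - k))%nat at 1 by lia.
    rewrite Cpow_add_r. ring. }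
  apply csum_iff. split.
  - pose proof (is_series_minus _ _ _ _ (is_series_mult _ _ _ _ HA1 HB1 A1 B1)
                 (is_series_mult _ _ _ _ HA2 HB2 A2 B2)) as H.
    replace (Re (A z * B z)%C) with (plus (Re (A z) * Re (B z)) (opp (Im (A z) * Im (B z))))
      by (destruct (A z), (B z); unfold plus, opp; simpl; ring).
    eapply is_series_ext; [|exact H]. intros n. cbv beta.
    rewrite re_scal_r, scal_sum.
    match goal with |- plus ?x (opp ?y) = ?r => change (x - y = r) end.
    rewrite <- minus_sum. apply sum_eq. intros k Hk.
    pose proof (f_equal Re (Hterm n k Hk)) as E. rewrite re_scal_r in E.
    cbv beta. rewrite (Rmult_comm (a k * _)), E. reflexivity.
  - pose proof (is_series_plus _ _ _ _ (is_series_mult _ _ _ _ HA1 HB2 A1 B2)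
                 (is_series_mult _ _ _ _ HA2 HB1 A2 B1)) as H.
    replace (Im (A z * B z)%C) with (plus (Re (A z) * Im (B z)) (Im (A z) * Re (B z)))
      by (destruct (A z), (B z); unfold plus; simpl; ring).
    eapply is_series_ext; [|exact H]. intros n. cbv beta.
    rewrite im_scal_r, scal_sum.
    match goal with |- plus ?x ?y = ?r => change (x + y = r) end.
    rewrite <- plus_sum. apply sum_eq. intros k Hk.
    pose proof (f_equal Im (Hterm n k Hk)) as E. rewrite im_scal_r in E.
    cbv beta. rewrite (Rmult_comm (a k * _)), E. reflexivity.
Qed.

(** Both sides solve [u' = q u]: the quotient [u e^(-v)] has derivative 0. *)
Lemma exp_of_logarithmic_derivative (u v q : C -> C) :
  (forall z, unit_disc z -> cder u z (q z * u z)%C) ->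
  (forall z, unit_disc z -> cder v z (q z)) -> u 0 = Cexp (v 0) ->
  forall z, unit_disc z -> u z = Cexp (v z).
Proof.
  intros Hu Hv H0 z Hz.
  assert (Hk : (u z * Cexp (- v z) = u 0 * Cexp (- v 0))%C).
  { apply (disc_zero_derivative (fun z => u z * Cexp (- v z))%C); [|exact Hz].
    intros w Hw. eapply cder_eq; [|apply cder_mult; [apply Hu, Hw|
      apply cder_comp; [apply cder_Cexp|apply cder_opp, Hv, Hw]]].
    cbv beta. ring. }
  assert (E : forall x : C, (Cexp x * Cexp (- x) = 1)%C).
  { intros x. rewrite <- Cexp_plus. replace (x + - x)%C with (RtoC 0) by ring. apply Cexp_0. }
  rewrite H0, E in Hk.
  replace (u z) with (u z * (Cexp (v z) * Cexp (- v z)))%C by (rewrite E; ring).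
  replace (u z * (Cexp (v z) * Cexp (- v z)))%C with (Cexp (v z) * (u z * Cexp (- v z)))%C by ring.
  rewrite Hk. ring.
Qed.

(** * The bounds *)

Lemma unit_disc_0 : unit_disc 0.
Proof. unfold unit_disc. rewrite Cmod_0. lra. Qed.

Lemma cder_ext_disc (f g : C -> C) (z l : C) : (forall w, unit_disc w -> f w = g w) ->
  unit_disc z -> cder f z l -> cder g z l.
Proof.
  intros He Hz. unfold unit_disc in *. apply (cder_ext_loc f g z l (1 - Cmod z)). lra.
  intros w Hw. apply He. replace w with ((w - z) + z)%C by ring.
  eapply Rle_lt_trans. apply Cmod_triangle. lra.
Qed.

Lemma dot_le (a b : C) : Rabs (dot a b) <= Cmod a * Cmod b.
Proof.
  replace (dot a b) with (Re (Cconj a * b)%C) by (destruct a, b; unfold dot; simpl; ring).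
  eapply Rle_trans. apply re_le_Cmod. rewrite Cmod_mult, Cmod_conj. lra.
Qed.

(** Gronwall on a ray: for [u(t) = |g(t z)|^2] the hypothesis gives [t u' >= -2A u], so
    [t^(2A) u(t)] does not decrease; it is positive for small [t > 0], hence at [t = 1].
    The inequality also holds at a zero of [g], where [u = u' = 0], so the ray need not avoid
    zeros in advance. *)
Lemma ode_nonvanishing (g g1 : C -> C) (A : nat) :
  (forall z, unit_disc z -> cder g z (g1 z)) -> g 0 <> 0 ->
  (forall z, unit_disc z -> g z <> 0 -> Cmod (z * g1 z) <= INR A * Cmod (g z)) ->
  forall z, unit_disc z -> g z <> 0.
Proof.
  intros Hg H0 Hb z Hz Hgz.
  set (L := fun t : R => (0 + t * z)%C).
  set (u := fun t : R => dot (g (L t)) (g (L t))).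
  set (u1 := fun t : R => dot (g1 (L t) * z) (g (L t)) + dot (g (L t)) (g1 (L t) * z)).
  pose proof (Cmod_ge_0 z) as Hz0.
  assert (HL : forall t, 0 <= t <= 1 -> unit_disc (L t)).
  { intros t Ht. unfold L, unit_disc in *. rewrite Cplus_0_l, Cmod_mult, Cmod_R, Rabs_pos_eq by lra. nra. }
  assert (Hu : forall t, 0 <= t <= 1 -> is_derive u t (u1 t)).
  { intros t Ht. apply (rder_line_dot g g); apply Hg; apply (HL t Ht). }
  assert (Hu1 : forall t, 0 <= t <= 1 -> 0 <= INR (2 * A) * u t + t * u1 t).
  { intros t Ht. specialize (HL t Ht).
    assert (Hn : Cmod (t * (g1 (L t) * z)) * Cmod (g (L t)) <= INR A * (Cmod (g (L t)) * Cmod (g (L t)))).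
    { destruct (classic (g (L t) = 0)) as [E|E].
      - rewrite E, Cmod_0. lra.
      - specialize (Hb (L t) HL E).
        replace (t * (g1 (L t) * z))%C with (L t * g1 (L t))%C by (unfold L; ring).
        pose proof (Cmod_ge_0 (g (L t))). nra. }
    pose proof (dot_le (t * (g1 (L t) * z)) (g (L t))) as Hd.
    assert (E1 : t * u1 t = 2 * dot (t * (g1 (L t) * z)) (g (L t))).
    { unfold u1. generalize (g1 (L t) * z)%C (g (L t)). intros [x1 x2] [y1 y2]. unfold dot; simpl. ring. }
    assert (E2 : u t = Cmod (g (L t)) * Cmod (g (L t))).
    { unfold u. rewrite dot_self. ring. }
    rewrite E1, E2. apply Rabs_le_between in Hd. rewrite mult_INR. simpl INR at 1. lra. }
  destruct (cder_cont g 0 _ (Hg 0 unit_disc_0) (Cmod (g 0))) as [d [Hd Hc]].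
  { apply Cmod_gt_0. exact H0. }
  set (t0 := Rmin (d / 2) (1 / 2)).
  assert (Ht0 : 0 < t0) by (apply Rmin_pos; lra).
  assert (Ht0' : t0 <= d / 2 /\ t0 <= 1 / 2) by (split; [apply Rmin_l|apply Rmin_r]).
  assert (Hgt0 : g (L t0) <> 0).
  { intros E. specialize (Hc (L t0)). rewrite E in Hc.
    replace (L t0 - 0)%C with (t0 * z)%C in Hc by (unfold L; ring).
    rewrite Cmod_mult, Cmod_R, Rabs_pos_eq in Hc by lra.
    unfold unit_disc in Hz. specialize (Hc ltac:(nra)).
    replace (0 - g 0)%C with (- g 0)%C in Hc by ring. rewrite Cmod_opp in Hc. lra. }
  (* The exponent m + 1 in place of m = 2A, still monotone, avoids the derivative of t^0. *)
  set (m := (2 * A)%nat).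
  destruct (MVT_cor2 (fun t => t ^ S m * u t)
      (fun t => INR (S m) * t ^ m * u t + t ^ S m * u1 t) t0 1) as [c [E Hct]].
  - lra.
  - intros c Hct. apply is_derive_Reals.
    evar_last.
    apply (is_derive_mult (fun t => t ^ S m) u c).
    + apply is_derive_pow. apply @is_derive_id.
    + apply Hu. lra.
    + apply Rmult_comm.
    + unfold plus, mult, one; simpl Nat.pred. cbv beta. simpl (plus _ _). unfold plus; simpl Init.Nat.pred.
      unfold one; simpl. ring.
  - assert (Hpos : 0 <= INR (S m) * c ^ m * u c + c ^ S m * u1 c).
    { specialize (Hu1 c ltac:(lra)). rewrite S_INR. simpl pow.
      replace ((INR m + 1) * c ^ m * u c + c * c ^ m * u1 c) with
        (c ^ m * ((INR m * u c + c * u1 c) + u c)) by ring.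
      apply Rmult_le_pos. apply pow_le; lra.
      assert (0 <= u c) by (unfold u; rewrite dot_self; apply pow2_ge_0).
      unfold m. lra. }
    assert (Hut0 : 0 < u t0) by (unfold u; apply dot_self_pos; exact Hgt0).
    assert (Hut1 : u 1 = 0).
    { unfold u, L. replace (0 + 1 * z)%C with z by ring. rewrite Hgz. unfold dot; simpl; ring. }
    rewrite Hut1, Rmult_0_r in E.
    assert (0 < t0 ^ S m * u t0) by (apply Rmult_lt_0_compat; [apply pow_lt|]; lra).
    nra.
Qed.

(** With [S1 = F'], [f' = e^F k] for [k = 1 + z S1], and [P = 1 + z N] with
    [N = S1 + k'/k].  At 0 one finds [w' = N] and [w'' = 2 N' - N^2], where
    [N = 4 gamma_1] and [N' = 12 gamma_2 - 4 gamma_1^2]. *)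
Lemma second_coefficient_bound (f : C -> C) (gamma : nat -> C) :
  class_Ce f -> log_coefficients f gamma ->
  Cmod (12 * (gamma 2%nat - gamma 1%nat * gamma 1%nat)) <= 1 - Cmod (4 * gamma 1%nat) ^ 2.
Proof.
  intros [[_ [_ [Hf0 _]]] [w [Hwa [Hwb [Hw0 Hw]]]]] [F [[_ [HF0 HFe]] HFs]].
  set (a := fun n => (2 * gamma n)%C).
  assert (HFd : disc_series a F) by (apply disc_series_pseries; exact HFs).
  assert (Ha1 := abs_disc_cderiv _ (disc_series_abs _ _ HFd)).
  assert (Ha2 := abs_disc_cderiv _ Ha1). assert (Ha3 := abs_disc_cderiv _ Ha2).
  destruct (abs_disc_series _ Ha1) as [S1 HS1].
  destruct (abs_disc_series _ Ha2) as [S2 HS2].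
  destruct (abs_disc_series _ Ha3) as [S3 HS3].
  assert (DF := disc_series_derivative _ _ _ HFd HS1).
  assert (D1 := disc_series_derivative _ _ _ HS1 HS2).
  assert (D2 := disc_series_derivative _ _ _ HS2 HS3).
  assert (V1 := disc_series_0 _ _ HS1). assert (V2 := disc_series_0 _ _ HS2).
  unfold cderiv, a in V1, V2. simpl INR in V1, V2.
  assert (Hf : forall z, unit_disc z -> (z * Cexp (F z))%C = f z).
  { intros z Hz. destruct (classic (z = 0)) as [E|E].
    - rewrite E, Hf0. ring.
    - rewrite HFe by assumption. field. exact E. }
  set (k := fun z => (1 + z * S1 z)%C).
  set (k1 := fun z => (S1 z + z * S2 z)%C).
  set (k2 := fun z => (S2 z + (S2 z + z * S3 z))%C).
  assert (Dk : forall z, unit_disc z -> cder k z (k1 z)).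
  { intros z Hz. eapply cder_eq; [|apply cder_plus; [apply cder_const|apply cder_mult; [apply cder_id|apply D1, Hz]]].
    unfold k1. ring. }
  assert (Dk1 : forall z, unit_disc z -> cder k1 z (k2 z)).
  { intros z Hz. eapply cder_eq; [|apply cder_plus; [apply D1, Hz|apply cder_mult; [apply cder_id|apply D2, Hz]]].
    unfold k2. ring. }
  set (G := fun z => (Cexp (F z) * k z)%C).
  set (G1 := fun z => (Cexp (F z) * (S1 z * k z + k1 z))%C).
  assert (Df : forall z, unit_disc z -> C_derive f z = G z).
  { intros z Hz. apply is_C_derive_unique. apply (cder_ext_disc _ _ _ _ Hf Hz).
    eapply cder_eq; [|apply cder_mult; [apply cder_id|apply cder_comp; [apply cder_Cexp|apply DF, Hz]]].
    unfold G, k. cbv beta. ring. }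
  assert (DG : forall z, unit_disc z -> cder G z (G1 z)).
  { intros z Hz.
    eapply cder_eq; [|apply cder_mult; [apply cder_comp; [apply cder_Cexp|apply DF, Hz]|apply Dk, Hz]].
    unfold G1. cbv beta. ring. }
  assert (Df2 : forall z, unit_disc z -> C_derive (C_derive f) z = G1 z).
  { intros z Hz. apply is_C_derive_unique. apply (cder_ext_disc G); [|exact Hz|apply DG, Hz].
    intros y Hy. symmetry. apply Df, Hy. }
  assert (HE : forall z, unit_disc z -> (1 + z * G1 z / G z)%C = Cexp (w z)).
  { intros z Hz. rewrite <- Df, <- Df2 by exact Hz. apply Hw. exact Hz. }
  assert (HGnz : forall z, unit_disc z -> G z <> 0).
  (* The constant 4 bounds |e^w - 1| <= e + 1. *)
  { apply (ode_nonvanishing G G1 4 DG).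
    - unfold G, k. rewrite HF0, Cexp_0. replace (1 * (1 + 0 * S1 0))%C with (RtoC 1) by ring. apply C1_nz.
    - intros z Hz HGz. specialize (HE z Hz).
      replace (z * G1 z)%C with ((Cexp (w z) - 1) * G z)%C by (rewrite <- HE; field; exact HGz).
      rewrite Cmod_mult. apply Rmult_le_compat_r. apply Cmod_ge_0.
      eapply Rle_trans. apply (Cmod_triangle _ (- (1))). rewrite Cmod_opp, Cmod_1, Cmod_Cexp.
      assert (exp (Re (w z)) <= exp 1).
      { specialize (Hwb z Hz). unfold unit_disc in Hwb.
        pose proof (re_le_Cmod (w z)) as Hr. apply Rabs_le_between in Hr.
        left. apply exp_increasing. lra. }
      pose proof exp_le_3. simpl INR. lra. }
  assert (Hk : forall z, unit_disc z -> k z <> 0).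
  { intros z Hz E. apply (HGnz z Hz). unfold G. rewrite E. ring. }
  set (N := fun z => (S1 z + k1 z / k z)%C).
  set (N1 := fun z => (S2 z + (k2 z * k z - k1 z * k1 z) / (k z * k z))%C).
  assert (DN : forall z, unit_disc z -> cder N z (N1 z)).
  { intros z Hz. apply cder_plus. apply D1, Hz. apply cder_div. apply Hk, Hz. apply Dk1, Hz. apply Dk, Hz. }
  set (P := fun z => (1 + z * N z)%C).
  set (P1 := fun z => (N z + z * N1 z)%C).
  assert (DP : forall z, unit_disc z -> cder P z (P1 z)).
  { intros z Hz. eapply cder_eq; [|apply cder_plus; [apply cder_const|apply cder_mult; [apply cder_id|apply DN, Hz]]].
    unfold P1. ring. }
  assert (HPw : forall z, unit_disc z -> Cexp (w z) = P z).
  { intros z Hz. rewrite <- HE by exact Hz. unfold P, N, G1, G. field. split. apply Hk, Hz.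
    apply Cexp_neq_0. }
  assert (HPnz : forall z, unit_disc z -> P z <> 0).
  { intros z Hz. rewrite <- HPw by exact Hz. apply Cexp_neq_0. }
  assert (Dw : forall z, unit_disc z -> cder w z (P1 z / P z)%C).
  { intros z Hz.
    assert (Hd : exists l : C, cder w z l) by exact (Hwa z Hz). destruct Hd as [l Hl].
    assert (E : (l * Cexp (w z))%C = P1 z).
    { apply (cder_unique P z). 2: apply DP, Hz.
      apply (cder_ext_disc _ _ _ _ HPw Hz). apply cder_comp. apply cder_Cexp. exact Hl. }
    rewrite <- E, HPw by exact Hz. eapply cder_eq; [|exact Hl]. field. apply HPnz, Hz. }
  assert (Hh : forall n, hol n unit_disc S1 /\ hol n unit_disc S2 /\ hol n unit_disc S3).
  { intros n. repeat split; [apply (disc_series_hol n _ _ HS1)|apply (disc_series_hol n _ _ HS2)|apply (disc_series_hol n _ _ HS3)]. }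
  destruct (Hh 1%nat) as [h1 [h2 h3]].
  assert (hk : hol 1 unit_disc k) by (exists k1; split; [exact Dk|exact I]).
  assert (hk1 : hol 1 unit_disc k1) by (exists k2; split; [exact Dk1|exact I]).
  assert (hk2 : hol 1 unit_disc k2).
  { apply hol_plus. exact h2. apply hol_plus. exact h2. apply hol_mult. apply hol_id. exact h3. }
  assert (hN1 : hol 1 unit_disc N1).
  { apply hol_plus. exact h2. apply hol_div.
    - intros z Hz. apply Cmult_neq_0; apply Hk, Hz.
    - apply hol_minus; apply hol_mult; assumption.
    - apply hol_mult; assumption. }
  assert (hN : hol 1 unit_disc N) by (exists N1; split; [exact DN|exact I]).
  assert (hP : hol 1 unit_disc P) by (exists P1; split; [exact DP|exact I]).
  assert (hw : hol 2 unit_disc w).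
  { exists (fun z => P1 z / P z)%C. split. exact Dw. apply hol_div. exact HPnz.
    apply hol_plus. exact hN. apply hol_mult. apply hol_id. exact hN1. exact hP. }
  assert (Dw2 : cder (fun z => P1 z / P z)%C 0 (2 * N1 0 - N 0 * N 0)%C).
  { destruct hN1 as [N2 [DN1 _]].
    eapply cder_eq; [|apply cder_div; [apply HPnz, unit_disc_0|apply cder_plus;
      [apply DN, unit_disc_0|apply cder_mult; [apply cder_id|apply DN1, unit_disc_0]]|apply DP, unit_disc_0]].
    cbv beta. unfold P, P1. field. }
  pose proof (schwarz_pick_coefficient w (fun z => P1 z / P z)%C _ hw Dw Dw2 Hw0
     (fun z Hz => Rlt_le _ _ (Hwb z Hz))) as HSP.
  cbv beta in HSP.
  replace (P1 0 / P 0)%C with (4 * gamma 1%nat)%C in HSP.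
  2:{ unfold P1, P, N, k1, k. rewrite V1. field. }
  replace ((2 * N1 0 - N 0 * N 0) / 2)%C with (12 * (gamma 2%nat - gamma 1%nat * gamma 1%nat))%C in HSP.
  2:{ unfold N1, N, k2, k1, k. rewrite V1, V2, RtoC_plus. field. }
  exact HSP.
Qed.

(** With [X = gamma_1^2 <= 1/16], the hypothesis puts [|gamma_2|] between [(28 X - 1) / 12] and
    [1/12 - X/3].  The lower estimate of [T21] is then increasing in [X]; in the upper one,
    [X] alone suffices when [28 X <= 1], and [X - ((28 X - 1) / 12)^2] is increasing up to
    [X = 1/16] otherwise. *)
Lemma T21_bounds (gamma : nat -> C) : Im (gamma 1%nat) = 0 ->
  Cmod (12 * (gamma 2%nat - gamma 1%nat * gamma 1%nat)) <= 1 - Cmod (4 * gamma 1%nat) ^ 2 ->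
  - 1 / 144 <= T21 gamma <= 15 / 256.
Proof.
  intros Him H. unfold T21.
  set (x := Re (gamma 1%nat)) in *.
  assert (E : gamma 1%nat = RtoC x). { apply injective_projections. reflexivity. exact Him. }
  rewrite E in H. rewrite !Cmod_mult, !Cmod_R, !(Rabs_pos_eq 12), (Rabs_pos_eq 4) in H by lra.
  set (y := Cmod (gamma 2%nat)).
  assert (Hx : (4 * Rabs x) ^ 2 = 16 * x ^ 2) by (rewrite <- (pow2_abs x); ring).
  rewrite Hx in H.
  pose proof (Cmod_triangle_rev (gamma 2%nat) (x * x)) as H1.
  pose proof (Cmod_triangle (gamma 2%nat - x * x) (x * x)) as H2.
  replace (gamma 2%nat - x * x + x * x)%C with (gamma 2%nat) in H2 by ring.
  pose proof (Cmod_triangle_rev (x * x) (gamma 2%nat)) as H3.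
  replace (x * x - gamma 2%nat)%C with (- (gamma 2%nat - x * x))%C in H3 by ring.
  rewrite Cmod_opp in H3.
  assert (Hxx : Cmod (x * x) = x ^ 2).
  { rewrite Cmod_mult, Cmod_R, <- Rabs_mult, Rabs_pos_eq by nra. ring. }
  rewrite Hxx in *. fold y in H1, H2, H3.
  pose proof (Cmod_ge_0 (gamma 2%nat)) as Hy. fold y in Hy.
  set (D := Cmod (gamma 2%nat - x * x)) in *.
  set (X := x ^ 2) in *.
  assert (HX : 0 <= X) by (unfold X; nra).
  assert (HD : 0 <= D) by (unfold D; apply Cmod_ge_0).
  assert (HX1 : X <= 1 / 16) by lra.
  assert (Hy1 : y <= 1 / 12 - X / 3) by lra.
  assert (Hy2 : (28 * X - 1) / 12 <= y) by lra.
  split.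
  - assert (y ^ 2 <= (1 / 12 - X / 3) ^ 2) by nra. nra.
  - destruct (Rle_lt_dec (28 * X) 1). nra.
    assert (((28 * X - 1) / 12) ^ 2 <= y ^ 2) by nra. nra.
Qed.

(** * Construction of functions with prescribed [w] *)

Definition conv (a b : nat -> R) (n : nat) : R := sum_f_R0 (fun k => a k * b (n - k)%nat) n.

Definition antider (a : nat -> R) (n : nat) : R :=
  match n with O => 0 | S k => a k / INR (S k) end.

Lemma INR_S_pos (n : nat) : 0 < INR (S n).
Proof. apply lt_0_INR. lia. Qed.

Lemma rseries_derivative (a a1 : nat -> R) (A A1 : C -> C) :
  rseries a A -> rseries a1 A1 -> (forall n, INR (S n) * a (S n) = a1 n) ->
  forall z, unit_disc z -> cder A z (A1 z).
Proof.
  intros HA HA1 H. apply (disc_series_derivative _ _ _ HA).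
  intros z Hz. refine (csum_ext _ _ _ _ (HA1 z Hz)).
  intros n. unfold cderiv. rewrite <- H, RtoC_mult. reflexivity.
Qed.

Lemma rseries_shift (a : nat -> R) (c : R) (A : C -> C) : rseries a A ->
  rseries (fun n => match n with O => c | S k => a k end) (fun z => c + z * A z)%C.
Proof.
  intros H z Hz. replace (c + z * A z)%C with (z * A z + z ^ 0 * c)%C by (simpl; ring).
  apply (csum_shift (fun n => z ^ n * RtoC (match n with O => c | S k => a k end))%C).
  refine (csum_ext _ _ _ _ (csum_scal z _ _ (H z Hz))).
  intros n. simpl. ring.
Qed.

Lemma rseries_exists (a : nat -> R) : (forall n, Rabs (a n) <= INR (S n)) -> exists A, rseries a A.
Proof.
  intros H. apply abs_disc_series.
  assert (H1 : abs_disc (fun _ => RtoC 1)).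
  { apply abs_disc_of_bound. intros r Hr. exists 1. intros n. rewrite Cmod_1, Rmult_1_l.
    rewrite <- (pow1 n). apply pow_incr. lra. }
  intros r Hr. apply abs_disc_cderiv in H1. specialize (H1 r Hr).
  apply (@ex_series_le R_AbsRing R_CompleteNormedModule _ _ ) with (2 := H1).
  intros n. match goal with |- norm ?x <= _ => change (norm x) with (Rabs x) end.
  pose proof (pow_le r n (proj1 Hr)).
  rewrite Rabs_mult, (Rabs_pos_eq (r ^ n)) by assumption.
  apply Rmult_le_compat_r. assumption.
  unfold cderiv. rewrite Cmult_1_r, !Cmod_R, Rabs_Rabsolu, (Rabs_pos_eq (INR _)) by apply pos_INR.
  apply H.
Qed.

Lemma bounded_coeff_le (a : nat -> R) : (forall n, 0 <= a n <= 1) ->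
  forall n, Rabs (a n) <= INR (S n).
Proof.
  intros Ha n. rewrite Rabs_pos_eq by apply Ha. rewrite S_INR.
  pose proof (pos_INR n). specialize (Ha n). lra.
Qed.

Lemma rseries_antiderivative (a : nat -> R) (A : C -> C) :
  (forall n, Rabs (a n) <= INR (S n)) -> rseries a A ->
  exists F, rseries (antider a) F /\ F 0 = 0 /\ forall z, unit_disc z -> cder F z (A z).
Proof.
  intros Hb HA.
  destruct (rseries_exists (antider a)) as [F HF].
  { intros [|n]; unfold antider. rewrite Rabs_R0. apply pos_INR.
    pose proof (INR_S_pos n). unfold Rdiv. rewrite Rabs_mult, Rabs_inv, (Rabs_pos_eq (INR _)) by lra.
    apply Rle_div_l. lra. specialize (Hb n). rewrite (S_INR (S n)). nra. }
  exists F. split. exact HF. split. exact (disc_series_0 _ _ HF).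
  apply (rseries_derivative _ _ _ _ HF HA). intros n. unfold antider. field.
  pose proof (INR_S_pos n). lra.
Qed.

Lemma strong_recursion (Phi : nat -> (nat -> R) -> R) :
  (forall n u v, (forall k, (k < n)%nat -> u k = v k) -> Phi n u = Phi n v) ->
  exists g, forall n, g n = Phi n g.
Proof.
  intros Hext.
  set (tab := fix tab (n : nat) : nat -> R := match n with
     | O => fun _ => 0
     | S m => fun k => if Nat.eqb k m then Phi m (tab m) else tab m k end).
  set (g := fun n => tab (S n) n).
  assert (H : forall n k, (k < n)%nat -> tab n k = g k).
  { induction n as [|n IH]; intros k Hk. lia.
    destruct (Nat.eq_dec k n) as [->|Hne]. reflexivity.
    simpl. rewrite (proj2 (Nat.eqb_neq k n) Hne). apply IH. lia. }
  exists g. intros n. unfold g at 1. simpl. rewrite Nat.eqb_refl. apply Hext. apply H.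
Qed.

Lemma sum_f_R0_rev (a : nat -> R) (n : nat) :
  sum_f_R0 (fun k => a (n - k)%nat) n = sum_f_R0 a n.
Proof.
  induction n as [|n IH]. reflexivity.
  rewrite decomp_sum by lia. simpl pred. rewrite Nat.sub_0_r.
  change (a (S n) + sum_f_R0 (fun k => a (n - k)%nat) n = sum_f_R0 a n + a (S n)).
  rewrite IH. ring.
Qed.

Lemma sum_f_R0_mono (a : nat -> R) (n m : nat) : (forall k, 0 <= a k) -> (n <= m)%nat ->
  sum_f_R0 a n <= sum_f_R0 a m.
Proof.
  intros Ha H. induction H as [|m H IH]. lra. simpl. specialize (Ha (S m)). lra.
Qed.

(** The coefficients [p] of [B'/B], where [B = 1 + b_1 z + ...].  From
    [p_n = (n+1) b_(n+1) - (p_0 b_n + ... + p_(n-1) b_1)] and [b_1 + b_2 + ... <= 1] one gets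
    [|p_n| <= 1 + max_(k<n) |p_k|], whence linear growth.  So [B] has a logarithm that is a
    power series on the whole disc. *)
Lemma log_coefficients_exist (b : nat -> R) : b O = 1 -> (forall n, 0 <= b n) ->
  (forall n, INR (S n) * b (S n) <= 1) ->
  (forall n, sum_f_R0 (fun j => b (S j)) n <= 1) ->
  exists p, (forall n, Rabs (p n) <= INR (S n)) /\ (forall n, INR (S n) * b (S n) = conv p b n).
Proof.
  intros Hb0 Hbp Hb1 Hbs.
  destruct (strong_recursion (fun n u => INR (S n) * b (S n) -
     match n with O => 0 | S m => sum_f_R0 (fun k => u k * b (n - k)%nat) m end)) as [p Hp].
  { intros [|m] u v Huv. reflexivity. f_equal. apply sum_eq. intros k Hk. rewrite Huv by lia. reflexivity. }
  exists p. split.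
  - intros n. induction n as [n IH] using (well_founded_induction Wf_nat.lt_wf).
    rewrite Hp.
    assert (H1 : Rabs (INR (S n) * b (S n)) <= 1).
    { rewrite Rabs_pos_eq. apply Hb1. apply Rmult_le_pos. apply pos_INR. apply Hbp. }
    destruct n as [|m].
    + rewrite Rminus_0_r. simpl INR at 2. exact H1.
    + assert (H2 : Rabs (sum_f_R0 (fun k => p k * b (S m - k)%nat) m) <= INR (S m)).
      { eapply Rle_trans. apply sum_f_R0_triangle.
        apply Rle_trans with (sum_f_R0 (fun k => b (S (m - k)) * INR (S m)) m).
        - apply sum_Rle. intros k Hk. rewrite Rabs_mult, (Rabs_pos_eq (b _)) by apply Hbp.
          replace (S m - k)%nat with (S (m - k)) by lia. rewrite Rmult_comm.
          apply Rmult_le_compat_l. apply Hbp. eapply Rle_trans. apply IH. lia. apply le_INR. lia.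
        - rewrite <- scal_sum. rewrite (sum_f_R0_rev (fun j => b (S j))).
          rewrite <- (Rmult_1_r (INR (S m))) at 2.
          apply Rmult_le_compat_l. apply pos_INR. apply Hbs. }
      eapply Rle_trans. apply Rabs_triang. rewrite Rabs_Ropp. pose proof (S_INR (S m)). lra.
  - intros [|m]; unfold conv.
    + simpl sum_f_R0. rewrite (Hp O), Hb0. ring.
    + rewrite tech5, Nat.sub_diag, Hb0, (Hp (S m)). ring.
Qed.

(** The coefficients of the solution of [G' = H G], [G(0) = 1]. *)
Definition growth_recursion (h g : nat -> R) : Prop :=
  g O = 1 /\ forall n, INR (S n) * g (S n) = conv h g n.

Lemma growth_recursion_exists (h : nat -> R) : exists g, growth_recursion h g.
Proof.
  destruct (strong_recursion (fun n u => match n with O => 1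
    | S m => sum_f_R0 (fun k => h k * u (m - k)%nat) m / INR (S m) end)) as [g Hg].
  { intros [|m] u v Huv. reflexivity. f_equal. apply sum_eq. intros k Hk. rewrite Huv by lia. reflexivity. }
  exists g. split. exact (Hg O). intros n. rewrite (Hg (S n)). unfold conv. field.
  pose proof (INR_S_pos n). lra.
Qed.

Lemma growth_recursion_bounds (h g : nat -> R) : (forall n, 0 <= h n <= 1) ->
  growth_recursion h g -> forall n, 0 <= g n <= 1.
Proof.
  intros Hh [H0 Hg] n. induction n as [n IH] using (well_founded_induction Wf_nat.lt_wf).
  destruct n as [|n]. lra.
  specialize (Hg n). pose proof (INR_S_pos n) as Hn.
  assert (H1 : 0 <= conv h g n).
  { apply cond_pos_sum. intros k.
    assert (H2 := IH (n - k)%nat ltac:(lia)). specialize (Hh k). nra. }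
  assert (H2 : conv h g n <= INR (S n)).
  { rewrite <- (Rmult_1_l (INR (S n))), <- sum_cte. apply sum_Rle. intros k Hk.
    assert (H2 := IH (n - k)%nat ltac:(lia)). specialize (Hh k). nra. }
  split; apply Rmult_le_reg_l with (INR (S n)); lra.
Qed.

(** The function [f] with [f' = G], where [G' = H G], satisfies [1 + z f''/f' = 1 + z H = e^w].
    The two numerical hypotheses give univalence and the power series of [log (f(z)/z)]. *)
Lemma extremal_function (h g : nat -> R) (H w : C -> C) :
  (forall n, 0 <= h n <= 1) -> growth_recursion h g -> rseries h H ->
  (forall n, sum_f_R0 (antider h) n <= 3 / 2) ->
  (forall n, sum_f_R0 (fun j => g (S j) / INR (S (S j))) n <= 1) ->
  analytic_on_disc w -> (forall z, unit_disc z -> unit_disc (w z)) -> w 0 = 0 ->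
  (forall z, unit_disc z -> (1 + z * H z)%C = Cexp (w z)) ->
  exists (f : C -> C) (gamma : nat -> C), class_Ce f /\ log_coefficients f gamma /\
    gamma 1%nat = RtoC (h O / 4) /\
    gamma 2%nat = RtoC (((h O ^ 2 + h 1%nat) / 3 - h O ^ 2 / 4) / 4).
Proof.
  intros Hh Hgr HH Hhs Hgs Hwa Hwd Hw0 Hw.
  pose proof (growth_recursion_bounds h g Hh Hgr) as Hgb. destruct Hgr as [Hg0 Hgr].
  set (b := fun n => g n / INR (S n)).
  assert (Hb0 : b O = 1) by (unfold b; rewrite Hg0; simpl; field).
  assert (Hbp : forall n, 0 <= b n).
  { intros n. apply Rdiv_le_0_compat. apply Hgb. apply INR_S_pos. }
  assert (Hb1 : forall n, INR (S n) * b (S n) <= 1).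
  { intros n. unfold b. pose proof (INR_S_pos n) as Hn. rewrite (S_INR (S n)).
    replace (INR (S n) * (g (S n) / (INR (S n) + 1))) with (INR (S n) * g (S n) / (INR (S n) + 1)) by (field; lra).
    apply Rle_div_l. lra. specialize (Hgb (S n)). nra. }
  destruct (log_coefficients_exist b Hb0 Hbp Hb1 Hgs) as [p [Hpb Hp]].
  destruct (rseries_exists g (bounded_coeff_le g Hgb)) as [G HG].
  destruct (rseries_exists p Hpb) as [P HP].
  destruct (rseries_antiderivative h H (bounded_coeff_le h Hh) HH) as [E [HE [HE0 DE]]].
  destruct (rseries_antiderivative p P Hpb HP) as [F [HF [HF0 DF]]].
  destruct (rseries_antiderivative g G (bounded_coeff_le g Hgb) HG) as [f [Hf [Hf0 Df]]].
  destruct (rseries_exists b) as [B HB].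
  { apply bounded_coeff_le. intros n. split. apply Hbp. unfold b. pose proof (INR_S_pos n).
    apply Rle_div_l. lra. rewrite S_INR. pose proof (pos_INR n). specialize (Hgb n). lra. }
  assert (DG : forall z, unit_disc z -> cder G z (H z * G z)%C).
  { apply (rseries_derivative _ _ _ _ HG (rseries_mult _ _ _ _ HH HG)). exact Hgr. }
  assert (DB : forall z, unit_disc z -> cder B z (P z * B z)%C).
  { apply (rseries_derivative _ _ _ _ HB (rseries_mult _ _ _ _ HP HB)). exact Hp. }
  assert (HGE : forall z, unit_disc z -> G z = Cexp (E z)).
  { apply (exp_of_logarithmic_derivative G E H DG DE).
    rewrite HE0, Cexp_0, (disc_series_0 _ _ HG), Hg0. reflexivity. }
  assert (HBF : forall z, unit_disc z -> B z = Cexp (F z)).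
  { apply (exp_of_logarithmic_derivative B F P DB DF).
    rewrite HF0, Cexp_0, (disc_series_0 _ _ HB), Hb0. reflexivity. }
  assert (HfB : forall z, unit_disc z -> f z = (z * B z)%C).
  { intros z Hz. apply (csum_unique _ _ _ (Hf z Hz)).
    pose proof (rseries_shift b 0 B HB z Hz) as HS. cbv beta in HS.
    replace (0 + z * B z)%C with (z * B z)%C in HS by ring.
    refine (csum_ext _ _ _ _ HS). intros [|n]; reflexivity. }
  assert (HGre : forall z, unit_disc z -> 0 < Re (G z)).
  { intros z Hz. rewrite HGE by exact Hz.
    assert (Hm : Cmod (E z) <= 3 / 2).
    { apply (csum_bound _ _ (antider h) (fun _ => 3 / 2) _ (HE z Hz)); [| |apply is_lim_seq_const].
      - intros n. rewrite Cmod_mult, Cmod_pow, Cmod_R.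
        assert (Ha : 0 <= antider h n).
        { destruct n; unfold antider. lra. apply Rdiv_le_0_compat. apply Hh. apply INR_S_pos. }
        rewrite Rabs_pos_eq by exact Ha.
        assert (Hpw : 0 <= Cmod z ^ n <= 1).
        { unfold unit_disc in Hz. pose proof (Cmod_ge_0 z). split. apply pow_le; lra.
          rewrite <- (pow1 n). apply pow_incr. lra. }
        nra.
      - intros n. rewrite sum_n_Reals. apply Hhs. }
    pose proof (im_le_Cmod (E z)) as Him. apply Rabs_le_between in Him.
    pose proof PI2_3_2. unfold Cexp. rewrite re_scal_l. simpl.
    apply Rmult_lt_0_compat. apply exp_pos. apply cos_gt_0; lra. }
  assert (HCf : forall z, unit_disc z -> C_derive f z = G z).
  { intros z Hz. apply is_C_derive_unique. apply Df, Hz. }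
  assert (HCf2 : forall z, unit_disc z -> C_derive (C_derive f) z = (H z * G z)%C).
  { intros z Hz. apply is_C_derive_unique. apply (cder_ext_disc G); [|exact Hz|apply DG, Hz].
    intros; symmetry; apply HCf; assumption. }
  exists f, (fun n => (antider p n / 2)%R : C). split; [split; [split; [|split; [|split]]|]|split; [|split]].
  - intros z Hz. exists (G z). apply Df, Hz.
  (* Re f' > 0 forces univalence: pair f(c) - f(a) with conj (c - a). *)
  - intros a c Ha Hc Heq. apply NNPP. intros Hne.
    destruct (complex_mvt f G a c (Cconj (c - a))) as [t [Ht Et]].
    { intros t Ht. apply Df. apply disc_segment; assumption. }
    rewrite Heq in Et. replace (f c - f c)%C with (RtoC 0) in Et by ring.
    rewrite Cmult_0_r in Et.
    replace (Cconj (c - a) * (G (a + t * (c - a))%C * (c - a)))%C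
      with ((Cmod (c - a) ^ 2)%R * G (a + t * (c - a))%C)%C in Et by (rewrite Cmod2_conj; ring).
    rewrite re_scal_l in Et. simpl Re at 1 in Et.
    assert (0 < Re (G (a + t * (c - a))%C)) by (apply HGre, disc_segment; assumption).
    assert (0 < Cmod (c - a)).
    { apply Cmod_gt_0. intros E0. apply Hne. symmetry. apply Ceq_minus. exact E0. }
    assert (0 < Cmod (c - a) ^ 2) by (apply pow_lt; assumption).
    simpl in Et. nra.
  - exact Hf0.
  - rewrite HCf by apply unit_disc_0. rewrite (disc_series_0 _ _ HG), Hg0. reflexivity.
  - exists w. repeat split; try assumption. intros z Hz. cbv beta.
    rewrite HCf2, HCf, <- Hw by exact Hz.
    assert (G z <> 0). { rewrite HGE by exact Hz. apply Cexp_neq_0. }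
    field. assumption.
  - exists F. split.
    + split; [|split]. intros z Hz. exists (P z). apply DF, Hz. exact HF0.
      intros z Hz Hz0. rewrite <- HBF, HfB by exact Hz. field. exact Hz0.
    + apply (proj1 (disc_series_pseries _ _)). intros z Hz.
      refine (csum_ext _ _ _ _ (HF z Hz)). intros n.
      rewrite RtoC_div by lra. field.
  - f_equal. unfold antider.
    assert (E1 := Hp O). assert (E2 := Hgr O). unfold conv, b in E1, E2. simpl in E1, E2. simpl.
    rewrite Hg0 in *. lra.
  - f_equal. unfold antider.
    assert (E1 := Hp O). assert (E2 := Hgr O). assert (E3 := Hp 1%nat). assert (E4 := Hgr 1%nat).
    unfold conv, b in E1, E2, E3, E4. simpl in E1, E2, E3, E4. simpl.
    rewrite Hg0 in *. 
    assert (Eg1 : g 1%nat = h O) by lra.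
    assert (Ep0 : p O = h O / 2) by lra.
    rewrite Eg1, Ep0 in *. lra.
Qed.

(** * The extremal functions for [w = z] and [w = z^2] *)

(** A geometric bound propagates through the recursion from index [K] on as soon as the
    partial sums of [(1/q) H(1/q)] are at most [n + 1]. *)
Lemma growth_recursion_geometric (h g : nat -> R) (c q : R) (K : nat) :
  growth_recursion h g -> (forall n, 0 <= h n) -> 0 < q ->
  (forall n, (n <= K)%nat -> g n <= c * q ^ n) ->
  (forall n, (K <= n)%nat -> sum_f_R0 (fun k => h k * (/ q) ^ S k) n <= INR (S n)) -> 0 <= c ->
  forall n, g n <= c * q ^ n.
Proof.
  intros [_ Hg] Hh Hq HK Hs Hc n.
  induction n as [n IH] using (well_founded_induction Wf_nat.lt_wf).
  destruct (Compare_dec.le_lt_dec n K) as [Hn|Hn]. auto.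
  destruct n as [|n]. lia.
  pose proof (INR_S_pos n) as Hpos. apply Rmult_le_reg_l with (INR (S n)). exact Hpos.
  rewrite Hg.
  apply Rle_trans with (sum_f_R0 (fun k => (h k * (/ q) ^ S k) * (c * q ^ S n)) n).
  - apply sum_Rle. intros k Hk. rewrite Rmult_assoc. apply Rmult_le_compat_l. apply Hh.
    eapply Rle_trans. apply IH. lia. right.
    replace (S n) with (S k + (n - k))%nat by lia. rewrite pow_add, pow_inv. field.
    apply pow_nonzero. lra.
  - rewrite <- scal_sum, Rmult_comm. apply Rmult_le_compat_r.
    apply Rmult_le_pos. exact Hc. apply pow_le; lra. apply Hs. lia.
Qed.

(** The sum of [b_n = g_n / (n + 1)], split into its first terms and a geometric tail whose
    denominators are replaced by the smallest one. *)
Lemma mean_sum_geometric (g : nat -> R) (c q : R) (M : nat) :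
  (forall n, 0 <= g n) -> (forall n, g n <= c * q ^ n) -> 0 < q < 1 -> 0 <= c ->
  forall N, sum_f_R0 (fun j => g (S j) / INR (S (S j))) N <=
    sum_f_R0 (fun j => g (S j) / INR (S (S j))) M + c * q ^ S (S M) / (INR (S (S (S M))) * (1 - q)).
Proof.
  intros Hg0 Hg Hq Hc N.
  set (a := fun j => g (S j) / INR (S (S j))).
  assert (Ha : forall k, 0 <= a k).
  { intros k. apply Rdiv_le_0_compat. apply Hg0. apply INR_S_pos. }
  set (D := INR (S (S (S M))) * (1 - q)).
  pose proof (INR_S_pos (S (S M))) as HM.
  assert (HD : 0 < D) by (apply Rmult_lt_0_compat; lra).
  assert (Hcq : forall n, 0 <= c * q ^ n / D).
  { intros n. apply Rdiv_le_0_compat; [|exact HD]. apply Rmult_le_pos. lra. apply pow_le; lra. }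
  destruct (Compare_dec.le_lt_dec N M) as [HN|HN].
  { pose proof (sum_f_R0_mono a N M Ha HN). specialize (Hcq (S (S M))). lra. }
  assert (H : forall n, (M <= n)%nat -> sum_f_R0 a n <=
     sum_f_R0 a M + c * q ^ S (S M) / D - c * q ^ S (S n) / D).
  { intros n Hn. induction Hn as [|n Hn IH]. lra.
    rewrite tech5.
    assert (Han : a (S n) <= c * q ^ S (S n) * (1 - q) / D).
    { unfold a, D. apply Rle_trans with (c * q ^ S (S n) / INR (S (S (S n)))).
      - unfold Rdiv. apply Rmult_le_compat_r. left. apply Rinv_0_lt_compat, INR_S_pos. apply Hg.
      - replace (c * q ^ S (S n) * (1 - q) / (INR (S (S (S M))) * (1 - q)))
          with (c * q ^ S (S n) / INR (S (S (S M)))) by (field; lra).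
        unfold Rdiv. apply Rmult_le_compat_l. apply Rmult_le_pos. lra. apply pow_le; lra.
        apply Rinv_le_contravar. exact HM. apply le_INR. lia. }
    replace (c * q ^ S (S (S n)) / D) with (c * q ^ S (S n) / D - c * q ^ S (S n) * (1 - q) / D)
      by (simpl; field; lra).
    lra. }
  specialize (H N ltac:(lia)). specialize (Hcq (S (S N))). lra.
Qed.

(** The coefficients of [e^z]. *)
Fixpoint exp_coeff (n : nat) : R :=
  match n with O => 1 | S k => exp_coeff k / INR (S k) end.

(** The coefficients of [e^(z^2)], from [u' = 2 z u]. *)
Fixpoint exp_sq_coeff (n : nat) : R :=
  match n with O => 1 | S O => 0 | S (S k) => 2 * exp_sq_coeff k / INR (S (S k)) end.

Lemma exp_coeff_S (n : nat) : exp_coeff (S n) = exp_coeff n / INR (S n).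
Proof. reflexivity. Qed.

Lemma exp_sq_coeff_SS (n : nat) : exp_sq_coeff (S (S n)) = 2 * exp_sq_coeff n / INR (S (S n)).
Proof. reflexivity. Qed.

Lemma exp_coeff_bounds (n : nat) : 0 <= exp_coeff n <= 1.
Proof.
  induction n as [|n IH]. simpl; lra.
  rewrite exp_coeff_S. pose proof (INR_S_pos n). split.
  apply Rdiv_le_0_compat; lra. apply Rle_div_l. lra.
  rewrite S_INR. pose proof (pos_INR n). lra.
Qed.

Lemma exp_sq_coeff_bounds (n : nat) : 0 <= exp_sq_coeff n <= 1.
Proof.
  assert (H : 0 <= exp_sq_coeff n <= 1 /\ 0 <= exp_sq_coeff (S n) <= 1); [|tauto].
  induction n as [|n [IH1 IH2]]. simpl; lra.
  split. exact IH2.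
  rewrite exp_sq_coeff_SS. pose proof (INR_S_pos (S n)). split.
  apply Rdiv_le_0_compat; lra. apply Rle_div_l. lra.
  rewrite !S_INR. pose proof (pos_INR n). lra.
Qed.

Lemma exp_coeff_series (H : C -> C) : rseries (fun n => exp_coeff (S n)) H ->
  forall z, unit_disc z -> (1 + z * H z)%C = Cexp z.
Proof.
  intros HH.
  assert (HU : rseries exp_coeff (fun z => 1 + z * H z)%C).
  { intros z Hz. refine (csum_ext _ _ _ _ (rseries_shift _ 1 H HH z Hz)).
    intros [|n]; reflexivity. }
  apply (exp_of_logarithmic_derivative (fun z => 1 + z * H z)%C (fun z => z) (fun _ => RtoC 1)).
  - intros z Hz. rewrite Cmult_1_l. refine (rseries_derivative _ _ _ _ HU HU _ z Hz).
    intros n. rewrite exp_coeff_S. field. pose proof (INR_S_pos n). lra.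
  - intros z _. apply cder_id.
  - rewrite Cexp_0. ring.
Qed.

Lemma exp_sq_coeff_series (H : C -> C) : rseries (fun n => exp_sq_coeff (S n)) H ->
  forall z, unit_disc z -> (1 + z * H z)%C = Cexp (z * z).
Proof.
  intros HH.
  assert (HU : rseries exp_sq_coeff (fun z => 1 + z * H z)%C).
  { intros z Hz. refine (csum_ext _ _ _ _ (rseries_shift _ 1 H HH z Hz)).
    intros [|n]; reflexivity. }
  assert (HU2 : rseries (fun n => 2 * exp_sq_coeff n) (fun z => 2 * (1 + z * H z))%C).
  { intros z Hz. refine (csum_ext _ _ _ _ (csum_scal 2 _ _ (HU z Hz))).
    intros n. rewrite RtoC_mult. ring. }
  apply (exp_of_logarithmic_derivative (fun z => 1 + z * H z)%C (fun z => z * z)%C (fun z => 2 * z)%C).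
  - intros z Hz. eapply cder_eq; [|refine (rseries_derivative _ _ _ _ HU (rseries_shift _ 0 _ HU2) _ z Hz)].
    + cbv beta. ring.
    + intros [|n]. simpl. ring. rewrite exp_sq_coeff_SS. field. pose proof (INR_S_pos (S n)). lra.
  - intros z _. eapply cder_eq; [|apply cder_mult; apply cder_id]. cbv beta. ring.
  - replace (0 * 0)%C with (RtoC 0) by ring. rewrite Cexp_0. ring.
Qed.

(** The true value is about 1.318; the next coefficient is added to make the induction work. *)
Lemma exp_coeff_antider_sum (N : nat) : sum_f_R0 (antider (fun n => exp_coeff (S n))) N <= 3 / 2.
Proof.
  assert (H : sum_f_R0 (antider (fun n => exp_coeff (S n))) (S N) + exp_coeff (S (S N)) <= 3 / 2).
  { induction N as [|N IH].
    - simpl. lra.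
    - rewrite tech5. change (antider (fun n => exp_coeff (S n)) (S (S N))) with (exp_coeff (S (S N)) / INR (S (S N))).
      rewrite (exp_coeff_S (S (S N))).
      pose proof (exp_coeff_bounds (S (S N))) as Hb. set (x := exp_coeff (S (S N))) in *.
      assert (H1 : x / INR (S (S N)) <= x / 2).
      { apply Rmult_le_compat_l. lra. apply Rinv_le_contravar. lra. rewrite !S_INR. pose proof (pos_INR N). lra. }
      assert (H2 : x / INR (S (S (S N))) <= x / 2).
      { apply Rmult_le_compat_l. lra. apply Rinv_le_contravar. lra. rewrite !S_INR. pose proof (pos_INR N). lra. }
      lra. }
  pose proof (exp_coeff_bounds (S (S N))).
  eapply Rle_trans; [apply (sum_f_R0_mono _ N (S N)); [|lia]|lra].
  intros [|k]; unfold antider. lra. apply Rdiv_le_0_compat. apply exp_coeff_bounds. apply INR_S_pos.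
Qed.

(** The next two coefficients make the induction work, as the recursion has step 2. *)
Lemma exp_sq_coeff_antider_sum (N : nat) : sum_f_R0 (antider (fun n => exp_sq_coeff (S n))) N <= 3 / 2.
Proof.
  assert (H : sum_f_R0 (antider (fun n => exp_sq_coeff (S n))) N + exp_sq_coeff (S N) + exp_sq_coeff (S (S N)) <= 3 / 2).
  { induction N as [|N IH].
    - simpl. lra.
    - rewrite tech5. change (antider (fun n => exp_sq_coeff (S n)) (S N)) with (exp_sq_coeff (S N) / INR (S N)).
      rewrite (exp_sq_coeff_SS (S N)).
      destruct N as [|N]. simpl. lra.
      pose proof (exp_sq_coeff_bounds (S (S N))) as Hb. set (x := exp_sq_coeff (S (S N))) in *.
      assert (H1 : x / INR (S (S N)) <= x / 2).
      { apply Rmult_le_compat_l. lra. apply Rinv_le_contravar. lra. rewrite !S_INR. pose proof (pos_INR N). lra. }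
      assert (H2 : 2 * x / INR (S (S (S (S N)))) <= 2 * x / 4).
      { apply Rmult_le_compat_l. lra. apply Rinv_le_contravar. lra. rewrite !S_INR. pose proof (pos_INR N). lra. }
      lra. }
  pose proof (exp_sq_coeff_bounds (S N)). pose proof (exp_sq_coeff_bounds (S (S N))). lra.
Qed.

(** The full sum is [e^2 - 1 < 6.4].  From index 2 on each term is at most half the one
    before, so twice the next term dominates the tail. *)
Lemma exp_coeff_weighted (N : nat) :
  sum_f_R0 (fun k => exp_coeff (S k) * (/ (1 / 2)) ^ S k) N <= 7.
Proof.
  replace (/ (1 / 2)) with 2 by field.
  set (x := fun k => exp_coeff (S k) * 2 ^ S k).
  assert (Hx : forall k, 0 <= x k).
  { intros k. apply Rmult_le_pos. apply exp_coeff_bounds. apply pow_le; lra. }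
  assert (H : sum_f_R0 x (S N) + 2 * x (S (S N)) <= 7).
  { induction N as [|N IH]. unfold x; simpl; lra.
    rewrite tech5.
    assert (2 * x (S (S (S N))) <= x (S (S N))).
    { unfold x at 1. rewrite (exp_coeff_S (S (S (S N)))).
      replace (2 * (exp_coeff (S (S (S N))) / INR (S (S (S (S N)))) * 2 ^ S (S (S (S N)))))
        with (x (S (S N)) * (4 / INR (S (S (S (S N)))))).
      2:{ unfold x. simpl pow. field. pose proof (INR_S_pos (S (S (S N)))). lra. }
      assert (4 / INR (S (S (S (S N)))) <= 1).
      { apply Rle_div_l. apply INR_S_pos. rewrite !S_INR. pose proof (pos_INR N). lra. }
      specialize (Hx (S (S N))). nra. }
    lra. }
  pose proof (Hx (S (S N))).
  eapply Rle_trans; [apply (sum_f_R0_mono x N (S N)); [exact Hx|lia]|lra].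
Qed.

(** The full sum is [e^(36/25) - 1 < 3.3].  From index 3 on a term is at least twice
    the term two places later, so the next two terms, doubled, dominate the tail. *)
Lemma exp_sq_coeff_weighted (N : nat) :
  sum_f_R0 (fun k => exp_sq_coeff (S k) * (/ (5 / 6)) ^ S k) N <= 4.
Proof.
  replace (/ (5 / 6)) with (6 / 5) by field.
  set (x := fun k => exp_sq_coeff (S k) * (6 / 5) ^ S k).
  assert (Hx : forall k, 0 <= x k).
  { intros k. apply Rmult_le_pos. apply exp_sq_coeff_bounds. apply pow_le; lra. }
  assert (H : sum_f_R0 x (S (S N)) + 2 * (x (S (S (S N))) + x (S (S (S (S N))))) <= 4).
  { induction N as [|N IH]. unfold x; simpl; lra.
    rewrite tech5.
    assert (2 * x (S (S (S (S (S N))))) <= x (S (S (S N)))).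
    { unfold x at 1. rewrite (exp_sq_coeff_SS (S (S (S (S N))))).
      match goal with |- 2 * (2 * _ / ?d * _) <= _ => set (D := d) end.
      assert (HD : 6 <= D). { unfold D. rewrite !S_INR. pose proof (pos_INR N). lra. }
      replace (2 * (2 * exp_sq_coeff (S (S (S (S N)))) / D * (6 / 5) ^ S (S (S (S (S (S N)))))))
        with (x (S (S (S N))) * ((144 / 25) / D)).
      2:{ unfold x. simpl pow. field. lra. }
      assert ((144 / 25) / D <= 1) by (apply Rle_div_l; lra).
      specialize (Hx (S (S (S N)))). nra. }
    lra. }
  pose proof (Hx (S (S (S N)))). pose proof (Hx (S (S (S (S N))))).
  eapply Rle_trans; [apply (sum_f_R0_mono x N (S (S N))); [exact Hx|lia]|lra].
Qed.

(** The sum of the [b_n] is about 0.96, which leaves little room: [g_1, ..., g_6] are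
    computed, and the tail is estimated by [g_n <= (13/3) / 2^n], where [13/3] exceeds
    [max_(n <= 6) 2^n g_n = 4.32]. *)
Lemma exp_growth_sum (g : nat -> R) : growth_recursion (fun n => exp_coeff (S n)) g ->
  forall N, sum_f_R0 (fun j => g (S j) / INR (S (S j))) N <= 1.
Proof.
  intros Hg N.
  pose proof (growth_recursion_bounds _ _ (fun n => exp_coeff_bounds (S n)) Hg) as Hb.
  pose proof Hg as [G0 HG].
  assert (G1 : g 1%nat = 1). { pose proof (HG 0%nat) as E. unfold conv in E. simpl in E. lra. }
  assert (G2 : g 2%nat = 3 / 4). { pose proof (HG 1%nat) as E. unfold conv in E. simpl in E. rewrite G0, G1 in E. lra. }
  assert (G3 : g 3%nat = 17 / 36). { pose proof (HG 2%nat) as E. unfold conv in E. simpl in E. rewrite G0, G1, G2 in E. lra. }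
  assert (G4 : g 4%nat = 19 / 72). { pose proof (HG 3%nat) as E. unfold conv in E. simpl in E. rewrite G0, G1, G2, G3 in E. lra. }
  assert (G5 : g 5%nat = 27 / 200). { pose proof (HG 4%nat) as E. unfold conv in E. simpl in E. rewrite G0, G1, G2, G3, G4 in E. lra. }
  assert (G6 : 0.0644 <= g 6%nat <= 0.0645). { pose proof (HG 5%nat) as E. unfold conv in E. simpl in E. rewrite G0, G1, G2, G3, G4, G5 in E. lra. }
  assert (Hgeo : forall n, g n <= 13 / 3 * (1 / 2) ^ n).
  { apply (growth_recursion_geometric _ _ _ _ 6 Hg).
    - intros n. apply exp_coeff_bounds.
    - lra.
    - intros n Hn. do 7 (destruct n as [|n]; [simpl; lra|]). lia.
    - intros n Hn. eapply Rle_trans. apply exp_coeff_weighted.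
      apply le_INR in Hn. rewrite S_INR. simpl in Hn. lra.
    - lra. }
  eapply Rle_trans.
  apply (mean_sum_geometric g (13 / 3) (1 / 2) 5 (fun n => proj1 (Hb n)) Hgeo); lra.
  simpl. rewrite G1, G2, G3, G4, G5. lra.
Qed.

(** Here [g_1 = g_3 = 0] leaves room for the crude estimate [g_n <= (5/6)^n]. *)
Lemma exp_sq_growth_sum (g : nat -> R) : growth_recursion (fun n => exp_sq_coeff (S n)) g ->
  forall N, sum_f_R0 (fun j => g (S j) / INR (S (S j))) N <= 1.
Proof.
  intros Hg N.
  pose proof (growth_recursion_bounds _ _ (fun n => exp_sq_coeff_bounds (S n)) Hg) as Hb.
  pose proof Hg as [G0 HG].
  assert (G1 : g 1%nat = 0). { pose proof (HG 0%nat) as E. unfold conv in E. simpl in E. lra. }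
  assert (G2 : g 2%nat = 1 / 2). { pose proof (HG 1%nat) as E. unfold conv in E. simpl in E. rewrite G0, G1 in E. lra. }
  assert (G3 : g 3%nat = 0). { pose proof (HG 2%nat) as E. unfold conv in E. simpl in E. rewrite G0, G1, G2 in E. lra. }
  assert (Hgeo : forall n, g n <= 1 * (5 / 6) ^ n).
  { apply (growth_recursion_geometric _ _ _ _ 3 Hg).
    - intros n. apply exp_sq_coeff_bounds.
    - lra.
    - intros n Hn. do 4 (destruct n as [|n]; [simpl; lra|]). lia.
    - intros n Hn. eapply Rle_trans. apply exp_sq_coeff_weighted.
      apply le_INR in Hn. rewrite S_INR. simpl in Hn. lra.
    - lra. }
  eapply Rle_trans.
  apply (mean_sum_geometric g 1 (5 / 6) 2 (fun n => proj1 (Hb n)) Hgeo); lra.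
  simpl. rewrite G1, G2, G3. lra.
Qed.

Lemma T21_real (gamma : nat -> C) (x y : R) : gamma 1%nat = RtoC x -> gamma 2%nat = RtoC y ->
  Im (gamma 1%nat) = 0 /\ T21 gamma = x ^ 2 - y ^ 2.
Proof.
  intros H1 H2. unfold T21. rewrite H1, H2. split. reflexivity.
  rewrite Cmod_R, pow2_abs. reflexivity.
Qed.

Lemma extremal_identity : exists (f : C -> C) (gamma : nat -> C),
  class_Ce f /\ log_coefficients f gamma /\ Im (gamma 1%nat) = 0 /\ T21 gamma = 15 / 256.
Proof.
  set (h := fun n => exp_coeff (S n)).
  destruct (growth_recursion_exists h) as [g Hg].
  destruct (rseries_exists h (bounded_coeff_le h (fun n => exp_coeff_bounds (S n)))) as [H HH].
  destruct (extremal_function h g H (fun z => z)) as [f [gamma [Hf [Hgam [E1 E2]]]]]; auto.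
  - intros n. apply exp_coeff_bounds.
  - apply exp_coeff_antider_sum.
  - apply exp_growth_sum. exact Hg.
  - intros z Hz. exists (RtoC 1). apply cder_id.
  - apply exp_coeff_series. exact HH.
  - exists f, gamma. destruct (T21_real gamma _ _ E1 E2) as [E3 E4].
    repeat split; try assumption; try apply Hf. rewrite E4. unfold h. simpl. field.
Qed.

Lemma extremal_square : exists (f : C -> C) (gamma : nat -> C),
  class_Ce f /\ log_coefficients f gamma /\ Im (gamma 1%nat) = 0 /\ T21 gamma = - 1 / 144.
Proof.
  set (h := fun n => exp_sq_coeff (S n)).
  destruct (growth_recursion_exists h) as [g Hg].
  destruct (rseries_exists h (bounded_coeff_le h (fun n => exp_sq_coeff_bounds (S n)))) as [H HH].
  destruct (extremal_function h g H (fun z => z * z)%C) as [f [gamma [Hf [Hgam [E1 E2]]]]]; auto.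
  - intros n. apply exp_sq_coeff_bounds.
  - apply exp_sq_coeff_antider_sum.
  - apply exp_sq_growth_sum. exact Hg.
  - intros z Hz. exists (1 * z + z * 1)%C. apply cder_mult; apply cder_id.
  - intros z Hz. unfold unit_disc in *. rewrite Cmod_mult. pose proof (Cmod_ge_0 z). nra.
  - ring.
  - apply exp_sq_coeff_series. exact HH.
  - exists f, gamma. destruct (T21_real gamma _ _ E1 E2) as [E3 E4].
    repeat split; try assumption; try apply Hf. rewrite E4. unfold h. simpl. field.
Qed.

Theorem theorem4p2 :
  (forall (f : C -> C) (gamma : nat -> C),
     class_Ce f -> log_coefficients f gamma -> Im (gamma 1%nat) = 0%R ->
     (- 1 / 144 <= T21 gamma <= 15 / 256)%R) /\
  (exists (f : C -> C) (gamma : nat -> C),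
     class_Ce f /\ log_coefficients f gamma /\ Im (gamma 1%nat) = 0%R /\
     T21 gamma = (- 1 / 144)%R) /\
  (exists (f : C -> C) (gamma : nat -> C),
     class_Ce f /\ log_coefficients f gamma /\ Im (gamma 1%nat) = 0%R /\
     T21 gamma = (15 / 256)%R).
Proof.
  split; [|split].
  - intros f gamma Hf Hg Him. apply T21_bounds. exact Him.
    exact (second_coefficient_bound f gamma Hf Hg).
  - exact extremal_square.
  - exact extremal_identity.
Qed.
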